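(* Let $m\ge 2$ and $J\ge 2$ be integers, let $p_1,\dots,p_J$ be distinct primes, let $S=\langle p_1,\dots,p_J\rangle=\{\ell_k\}_{k\ge1}$ with $1=\ell_1<\ell_2<\cdots$ be the multiplicative semigroup they generate, and let $\Omega\subset\Sigma_m=\{0,\dots,m-1\}^{\mathbb N}$ be a nonempty closed set. Let $\bar t=(t(u))_{u\in\mathrm{Pref}(\Omega)}\in[1,+\infty)^{\mathrm{Pref}(\Omega)}$ be a vector such that $$t(\varnothing)\in[1,m],\qquad t(u)\in\bigl[1,\,m^{\ell_k(\ell_{k+1}^{-1}+\ell_{k+2}^{-1}+\cdots)}\bigr]\quad\text{for } |u|=k,\ k\ge1,$$ $$t(\varnothing)^{\gamma(S)}=\sum_{j\in\mathrm{Pref}_1(\Omega)}t(j),$$ and $$t(u)^{\ell_{k+1}/\ell_k}=\sum_{j:\,uj\in\mathrm{Pref}_{k+1}(\Omega)}t(uj)\qquad\text{for all } u\in\mathrm{Pref}_k(\Omega),\ k\ge1.$$ Then $$\dim_H(X_\Omega^{(S)})=\log_m t(\varnothing).$$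
   Context: Here $\mathbb N=\{1,2,\dots\}$ and $S=\{p_1^{a_1}\cdots p_J^{a_J}: a_1,\dots,a_J\in\mathbb Z_{\ge0}\}$, with elements listed in increasing order as $1=\ell_1<\ell_2<\cdots$. Write $(i,S)=1$ if no $p_j$ ($1\le j\le J$) divides $i$. For $x=(x_k)_{k\ge1}\in\Sigma_m$ put $x|_{iS}:=(x_{i\ell_k})_{k\ge1}\in\Sigma_m$, and $$X_\Omega^{(S)}:=\{x\in\Sigma_m:\ x|_{iS}\in\Omega\ \text{for all } i\in\mathbb N \text{ with } (i,S)=1\}.$$ $\gamma(S):=\sum_{k=1}^\infty \frac1{\ell_k}$. For $k\ge1$, $\mathrm{Pref}_k(\Omega)=\{u\in\{0,\dots,m-1\}^k:\Omega\cap[u]\ne\emptyset\}$, where $[u]$ is the cylinder of all sequences starting with $u$; $\mathrm{Pref}_0(\Omega)=\{\varnothing\}$ consists of the empty word, and $\mathrm{Pref}(\Omega)=\bigcup_{k\ge0}\mathrm{Pref}_k(\Omega)$. $|u|$ is the length of the word $u$. A vector $\bar t$ with the listed properties always exists. $\Sigma_m$ carries the product topology; $\dim_H$ is Hausdorff dimension with respect to the metric $\varrho(x,y)=m^{-\min\{n:\,x_n\ne y_n\}}$ on $\Sigma_m$ (with $\varrho(x,x)=0$). *)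

(* Defs.v *)
From mathcomp Require Import all_boot all_order all_algebra.
From mathcomp Require Import all_classical all_reals all_analysis.

Set Implicit Arguments.
Unset Strict Implicit.
Unset Printing Implicit Defensive.

Import Order.TTheory GRing.Theory Num.Theory.
Import numFieldNormedType.Exports.

Local Open Scope classical_set_scope.
Local Open Scope ring_scope.

(** ** Hausdorff dimension with respect to a distance function *)

(* [0] is added to the set so that the empty set has diameter [0]. *)
Definition diam (R : realType) (T : Type) (d : T -> T -> R) (U : set T) :
    \bar R :=
  ereal_sup (0%E |` [set (d z.1 z.2)%:E | z in U `*` U]).

(* [diam U ^ s], with the convention that the empty set contributes [0] also
   when [s = 0]; a nonempty set of diameter [0] contributes [1] when [s = 0]. *)
Definition diam_pow (R : realType) (T : Type) (d : T -> T -> R) (s : R)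
    (U : set T) : \bar R :=
  if `[< U = set0 >] then 0%E else (diam d U `^ s)%E.

Definition delta_cover (R : realType) (T : Type) (d : T -> T -> R) (delta : R)
    (A : set T) : set (nat -> set T) :=
  [set U | A `<=` \bigcup_n U n /\ forall n, (diam d (U n) <= delta%:E)%E].

Definition hausdorff_premeasure (R : realType) (T : Type) (d : T -> T -> R)
    (delta s : R) (A : set T) : \bar R :=
  ereal_inf [set (\sum_(n <oo) diam_pow d s (U n))%E
            | U in delta_cover d delta A].

Definition hausdorff_measure (R : realType) (T : Type) (d : T -> T -> R)
    (s : R) (A : set T) : \bar R :=
  ereal_sup [set hausdorff_premeasure d delta s A
            | delta in [set delta : R | 0 < delta]].

Definition hausdorff_dim (R : realType) (T : Type) (d : T -> T -> R)
    (A : set T) : \bar R :=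
  ereal_inf [set s%:E | s in
    [set s : R | 0 <= s /\ hausdorff_measure d s A = 0%E]].

(** ** The symbolic space *)

(* Sequences indexed by {1, 2, ...} are stored with a shift: for [x : Sigma m],
   [x n] is the term of index [n + 1]. *)
Definition Sigma (m : nat) : Type :=
  prod_topology (fun _ : nat => discrete_topology 'I_m).

Definition rho (R : realType) (m : nat) (x y : Sigma m) : R :=
  match pselect (exists n, x n != y n) with
  | left neq_xy => m%:R ^- (ex_minn neq_xy).+1
  | right _ => 0
  end.

Definition cylinder (m : nat) (u : seq 'I_m) : set (Sigma m) :=
  [set x | mkseq x (size u) = u].

Definition Prefk (m : nat) (Omega : set (Sigma m)) (k : nat) : set (seq 'I_m) :=
  [set u | size u = k /\ Omega `&` cylinder u !=set0].

Definition Pref (m : nat) (Omega : set (Sigma m)) : set (seq 'I_m) :=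
  \bigcup_k Prefk Omega k.

(** ** The multiplicative semigroup and the multiplicatively invariant set *)

Definition semigroup (J : nat) (p : 'I_J -> nat) : set nat :=
  [set n | exists a : 'I_J -> nat, n = (\prod_(j < J) p j ^ a j)%N].

(* In all that follows, [ell k] is the element of index [k + 1] in the
   increasing list of the elements of the semigroup. *)
Definition increasing_enum (S : set nat) (ell : nat -> nat) : Prop :=
  {homo ell : j k / (j < k)%N} /\ range ell = S.

Definition restr (m : nat) (ell : nat -> nat) (i : nat) (x : Sigma m) :
    Sigma m :=
  fun k => x (i * ell k).-1.

Definition X_set (m J : nat) (p : 'I_J -> nat) (ell : nat -> nat)
    (Omega : set (Sigma m)) : set (Sigma m) :=
  [set x | forall i : nat, (0 < i)%N -> (forall j, ~~ (p j %| i)%N) ->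
    Omega (restr ell i x)].

Definition inv_sum_from (R : realType) (ell : nat -> nat) (k : nat) : R :=
  limn (fun n => \sum_(k <= j < n) (ell j)%:R^-1 : R).

Definition gamma (R : realType) (ell : nat -> nat) : R := inv_sum_from R ell 0.

Definition logb (R : realType) (b x : R) : R := ln x / ln b.

(* Main.v *)
Require Import Defs.
From mathcomp Require Import all_boot all_order all_algebra.
From mathcomp Require Import all_classical all_reals all_analysis.
From mathcomp Require Import ring lra.

Import Order.TTheory GRing.Theory Num.Theory.
Import numFieldNormedType.Exports.

Local Open Scope classical_set_scope.
Local Open Scope ring_scope.

Set Implicit Arguments.
Unset Strict Implicit.
Unset Printing Implicit Defensive.

(** Number the elements of the semigroup [S] from 1 and let [f] be the logarithm
    of [t].  The recursion for [t] says that, for a prefix [u] of length [k >= 1],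
    the numbers [t (u j) / t u ^ (ell_{k+1} / ell_k)] are conditional
    probabilities; so are the numbers [t j / t [::] ^ gamma] at the empty word.
    They define a probability on [Omega], given on words by [weight].  The
    positions 1, 2, 3, ... split into the classes [i S] with [i] prime to [S], and
    membership in the set [X] is an independent condition on each class.  An
    independent copy of that probability on each class yields a probability on
    [X], given on words by [mass].  The dimension is the exponential rate of decay
    of [mass (x_1 ... x_n)], in base [m].  Finite sums over words suffice: no
    measure on the sequence space is constructed.

    The classes met by the first [n] letters have representatives [i <= n], and
    there are about [n / gamma] of them: the representatives have a density [d]
    because coprimality is periodic, and [d * gamma = 1] because every integer is
    [i * ell_k] in exactly one way ([gamma_density]).  The factors
    [t [::] ^ gamma] therefore contribute about [t [::] ^ n] to [1 / mass], and
    the point is that the other factors do not change this rate.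

    Upper bound.  Along a single point of [X], average the logarithms of the other
    factors over [n] with the weights [1/n - 1/(n+1)].  The value of [f] at the
    word of length [k >= 1] read on the class of [i] enters with coefficient [-1]
    when [i ell_k <= n < i ell_{k+1}] and with coefficient
    [ell_{k+1} / ell_k - 1] when [n] is larger.  Over all [n] the two
    contributions cancel, and stopping at a finite [N] drops nonnegative terms
    only, so the average is at most 0 ([class_average]).  If [mass] stayed below
    [exp (- n (f [::] + eps))] from some [n] on, the average would grow like the
    harmonic series; hence every point has infinitely many prefixes of larger mass
    ([mass_large_infinitely_often]), and these prefixes give economical covers
    ([hausdorff_measure_eq0]).

    Lower bound.  The moments of order [lam] of [mass] factor over the classes,
    and truncating the classes at a level [K] only increases the factors.  To
    first order in [lam] a factor is governed by the entropy of the weights at its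
    level.  The increments of the entropy, weighted by the densities of the
    levels, telescope to [f [::]] up to a term controlled by the tail of the
    series [gamma]; this is where the upper bounds on [t] enter
    ([entropy_density]).  Markov's inequality then makes the total mass of the
    words of length [n] that are too heavy geometrically small
    ([sum_large_mass_geometric]).  By compactness, a cover of [X] of small
    Hausdorff sum can be replaced by finitely many cylinders, whose masses add up
    to at least 1 ([mass_cover_ge1]); the heavy cylinders contribute little, and
    the mass of the light ones is bounded by a power of their diameter: a
    contradiction. *)

(** * Words of a given length *)

Fixpoint words (T : finType) (n : nat) : seq (seq T) :=
  if n is n'.+1 then [seq rcons w j | w <- words T n', j <- enum T]
  else [:: [::]].

Lemma mem_words (T : finType) n (w : seq T) : (w \in words T n) = (size w == n).
Proof.
elim: n w => [|n IHn] w; first by rewrite inE size_eq0.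
apply/allpairsP/idP => [[[v j] /= [vn _ ->]]|].
  by rewrite size_rcons eqSS -IHn.
case/lastP: w => [//|v j]; rewrite size_rcons eqSS -IHn => vn.
by exists (v, j); rewrite mem_enum.
Qed.

Lemma words_uniq (T : finType) n : uniq (words T n).
Proof.
elim: n => //= n IHn; apply: allpairs_uniq => //; first exact: enum_uniq.
by move=> [v j] [v' j'] /= _ _ /rcons_inj [-> ->].
Qed.

Lemma big_words0 (R : realType) (T : finType) (F : seq T -> R) :
  \sum_(w <- words T 0) F w = F [::].
Proof. by rewrite big_seq1. Qed.

Lemma big_wordsS (R : realType) (T : finType) n (F : seq T -> R) :
  \sum_(w <- words T n.+1) F w =
  \sum_(w <- words T n) \sum_j F (rcons w j).
Proof. by rewrite big_allpairs_dep; apply: eq_bigr => w _; rewrite big_enum. Qed.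

Lemma sum_sub_uniq_le (R : realType) (I : eqType) (s s' : seq I)
    (Q : pred I) (F : I -> R) :
  uniq s -> uniq s' -> {subset s <= s'} -> (forall w, Q w -> 0 <= F w) ->
  \sum_(w <- s | Q w) F w <= \sum_(w <- s' | Q w) F w.
Proof.
move=> us us' ss' F0; rewrite [leRHS](bigID (mem s)) /=.
have -> : \sum_(w <- s' | Q w && (w \in s)) F w = \sum_(w <- s | Q w) F w.
  under eq_bigl do rewrite andbC.
  rewrite -big_filter_cond; apply: perm_big; apply: uniq_perm => //.
    exact: filter_uniq.
  by move=> w; rewrite mem_filter andb_idr//; exact: ss'.
by rewrite lerDl sumr_ge0 // => w /andP[Qw _]; exact: F0.
Qed.

Lemma sum_undup_le (R : realType) (I : eqType) (s : seq I) (F : I -> R) :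
  (forall i, 0 <= F i) -> \sum_(i <- undup s) F i <= \sum_(i <- s) F i.
Proof.
move=> F0; elim: s => [|i s IHs]; first by rewrite big_nil.
rewrite /= [leRHS]big_cons; case: ifP => _; last by rewrite big_cons lerD2l.
by apply: le_trans IHs _; rewrite lerDr.
Qed.

(** Allows families of words of mixed lengths, such as covers, to be estimated
    level by level. *)
Lemma sum_words_le (R : realType) (T : finType) (s : seq (seq T)) n0 n1
    (Q : pred (seq T)) (F : seq T -> R) :
  uniq s -> (forall w, Q w -> 0 <= F w) ->
  {in s, forall w, (n0 <= size w < n1)%N} ->
  \sum_(w <- s | Q w) F w <=
  \sum_(n0 <= n < n1) \sum_(w <- words T n | Q w) F w.
Proof.
move=> us F0 hs.
have -> : \sum_(w <- s | Q w) F w =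
    \sum_(n0 <= n < n1) \sum_(w <- [seq w <- s | size w == n] | Q w) F w.
  under [RHS]eq_bigr do rewrite big_filter_cond.
  rewrite (exchange_big_dep Q) /=; last by move=> n w _ /andP[].
  rewrite big_seq_cond [RHS]big_seq_cond; apply: eq_bigr => w /andP[ws Qw].
  rewrite (eq_bigl (pred1 (size w))); last first.
    by move=> n /=; rewrite Qw andbT eq_sym.
  by rewrite big_nat1_eq hs.
apply: ler_sum => n _; apply: sum_sub_uniq_le => //.
- exact: filter_uniq.
- exact: words_uniq.
- by move=> w; rewrite mem_filter mem_words => /andP[].
Qed.

(** * Gibbs weights on a tree of words *)

(** Think of [A] as the set of prefixes of [Omega], of [f] as the logarithm of the
    vector, and of [e k] as the exponent in its recursion at words of length
    [k]. *)
Record tree_system (R : realType) (T : finType) (A : pred (seq T))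
    (f : seq T -> R) (e : nat -> R) : Prop := TreeSystem {
  tree_nil : A [::];
  tree_rcons : forall w j, A (rcons w j) -> A w;
  tree_ge0 : forall w, A w -> 0 <= f w;
  tree_eq : forall w, A w -> expR (e (size w) * f w) =
     \sum_(j | A (rcons w j)) expR (f (rcons w j)) }.

Section TreeWeight.
Context (R : realType) (T : finType) (A : pred (seq T)) (f : seq T -> R)
  (e : nat -> R) (ts : tree_system A f e).

(** Logarithm of the product of the conditional probabilities
    [expR (f (w_1 ... w_{k+1})) / expR (e k * f (w_1 ... w_k))]. *)
Definition logw (w : seq T) : R :=
  \sum_(k < size w) (f (take k.+1 w) - e k * f (take k w)).

Definition weight (w : seq T) : R := if A w then expR (logw w) else 0.

Lemma logw_nil : logw [::] = 0. Proof. by rewrite /logw big_ord0. Qed.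

Lemma logw_rcons w j :
  logw (rcons w j) = logw w + (f (rcons w j) - e (size w) * f w).
Proof.
rewrite /logw size_rcons big_ord_recr /=; congr (_ + _).
  apply: eq_bigr => k _.
  by rewrite -cats1 !takel_cat // ltnW.
by rewrite (@take_oversize _ (size w).+1) ?size_rcons// -cats1 take_size_cat.
Qed.

Lemma weight_nil : weight [::] = 1.
Proof. by rewrite /weight (tree_nil ts) logw_nil expR0. Qed.

Lemma weight_ge0 w : 0 <= weight w.
Proof. by rewrite /weight; case: ifP => // _; exact: expR_ge0. Qed.

(** The recursion for [f] is exactly what makes the weights additive. *)
Lemma sum_weight_rcons w : \sum_j weight (rcons w j) = weight w.
Proof.
rewrite /weight; case: ifPn => Aw; last first.
  by apply: big1 => j _; case: ifP => // /(tree_rcons ts); rewrite (negPf Aw).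
rewrite -big_mkcond /=.
under eq_bigr do rewrite logw_rcons addrCA expRD.
by rewrite -mulr_suml -(tree_eq ts)// -expRD addrCA subrr addr0.
Qed.

Lemma sum_weight n : \sum_(w <- words T n) weight w = 1.
Proof.
elim: n => [|n IHn]; first by rewrite big_words0 weight_nil.
by rewrite big_wordsS; under eq_bigr do rewrite sum_weight_rcons.
Qed.

Lemma f_rcons_le w j : A (rcons w j) -> f (rcons w j) <= e (size w) * f w.
Proof.
move=> Awj; rewrite -ler_expR (tree_eq ts) ?(tree_rcons ts Awj)//.
by rewrite (bigD1 j)//= lerDl sumr_ge0 // => k _; exact: expR_ge0.
Qed.

Lemma logw_le0 w : A w -> logw w <= 0.
Proof.
elim/last_ind: w => [|w j IHw]; first by rewrite logw_nil.
move=> Awj; rewrite logw_rcons -(addr0 0) lerD ?IHw ?(tree_rcons ts Awj)//.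
by rewrite subr_le0 f_rcons_le.
Qed.

Definition entropy n : R := - \sum_(w <- words T n) weight w * logw w.

Definition mean_f n : R := \sum_(w <- words T n) weight w * f w.

(** Moment generating function of [logw] under the weights of level [n]. *)
Definition mgf (lam : R) n : R :=
  \sum_(w <- words T n) weight w * expR (lam * logw w).

Lemma entropy0 : entropy 0 = 0.
Proof. by rewrite /entropy big_words0 logw_nil mulr0 oppr0. Qed.

Lemma entropyS n : entropy n.+1 = entropy n + (e n * mean_f n - mean_f n.+1).
Proof.
rewrite /entropy /mean_f !big_wordsS mulr_sumr -sumrN -!sumrB.
rewrite -sumrN -big_split /= big_seq [RHS]big_seq.
apply: eq_bigr => w; rewrite mem_words => /eqP wn.
under eq_bigr do rewrite logw_rcons wn.
under eq_bigr do rewrite mulrDr mulrBr.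
rewrite big_split sumrB /= -!mulr_suml sum_weight_rcons.
by ring.
Qed.

Lemma entropy_sum n :
  entropy n = \sum_(j < n) (e j * mean_f j - mean_f j.+1).
Proof.
elim: n => [|n IHn]; first by rewrite big_ord0 entropy0.
by rewrite entropyS big_ord_recr IHn.
Qed.

Lemma mgf_ge0 lam n : 0 <= mgf lam n.
Proof. by apply: sumr_ge0 => w _; rewrite mulr_ge0 ?weight_ge0 ?expR_ge0. Qed.

(** Conditional weights are at most 1, so longer words have smaller moments. *)
Lemma mgfS_le lam n : 0 <= lam -> mgf lam n.+1 <= mgf lam n.
Proof.
move=> lam0; rewrite /mgf big_wordsS; apply: ler_sum => w _.
rewrite -sum_weight_rcons mulr_suml; apply: ler_sum => j _.
rewrite {1 2}/weight; case: ifP => Awj; last by rewrite !mul0r.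
rewrite ler_wpM2l ?expR_ge0// ler_expR ler_wpM2l// logw_rcons.
by rewrite gerDl subr_le0 f_rcons_le.
Qed.

Lemma mgf_le lam n K : 0 <= lam -> mgf lam n <= mgf lam (minn n K).
Proof.
move=> lam0; have mono a b : mgf lam (a + b) <= mgf lam a.
  elim: b => [|b IHb]; first by rewrite addn0.
  by rewrite addnS (le_trans (mgfS_le _ lam0)).
by rewrite -{1}(subnKC (geq_minl n K)) mono.
Qed.

(** Comes from [exp y <= 1 + y + y ^ 2] for [y <= 0], applied to
    [y = lam * logw w]. *)
Lemma mgf_entropy lam n : 0 <= lam ->
  mgf lam n <=
  expR (- lam * entropy n +
        lam ^+ 2 * \sum_(w <- words T n) weight w * logw w ^+ 2).
Proof.
move=> lam0; apply: le_trans (expR_ge1Dx _).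
rewrite /entropy mulNr mulrN opprK !mulr_sumr -(sum_weight n) -!big_split /=.
apply: ler_sum => w _; rewrite {1 2 3 4}/weight; case: ifP => Aw; last first.
  by rewrite !mul0r !mulr0 !addr0.
set E := expR (logw w); have E0 : 0 <= E by exact: expR_ge0.
have -> : E + (lam * (E * logw w) + lam ^+ 2 * (E * logw w ^+ 2)) =
   E * (1 + lam * logw w + (lam * logw w) ^+ 2) by ring.
apply: ler_wpM2l => //.
set y := lam * logw w.
have y0 : y <= 0 by rewrite mulr_ge0_le0 // logw_le0.
have := expR_ge1Dx (- y); have := expRxMexpNx_1 y.
have := expR_gt0 (- y); set z := expR (- y) => z0 yz hz.
rewrite -(ler_pM2r z0) yz.
apply: le_trans (_ : (1 + y + y ^+ 2) * (1 - y) <= _); last first.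
  by apply: ler_wpM2l => //; nra.
by nra.
Qed.

End TreeWeight.

(** * Words seen along the multiplicative classes *)

(** The classes are the sets [i S]: [ell] lists [S] from index 0, [cop] selects
    the integers prime to [S], and unique factorization is what makes the classes
    a partition of the positive integers. *)
Record factor_system (ell : nat -> nat) (cop : pred nat) : Prop :=
  FactorSystem {
    cop_gt0 : forall i, cop i -> (0 < i)%N;
    ell_0 : ell 0 = 1%N;
    ell_mono : {homo ell : j k / (j < k)%N};
    factor_ex : forall n, (0 < n)%N ->
      exists i k, cop i /\ n = (i * ell k)%N;
    factor_uniq : forall i i' k k', cop i -> cop i' ->
      (i * ell k = i' * ell k')%N -> i = i' /\ k = k' }.

Section Classes.
Context (T : finType) (j0 : T) (ell : nat -> nat) (cop : pred nat)
  (fs : factor_system ell cop).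

Lemma ltn_ell : {mono ell : j k / (j < k)%N}.
Proof. exact: leqW_mono (leq_mono (ell_mono fs)). Qed.

Lemma leq_ell : {mono ell : j k / (j <= k)%N}.
Proof. exact: leq_mono (ell_mono fs). Qed.

Lemma ell_gtn k : (k < ell k)%N.
Proof.
elim: k => [|k IHk]; first by rewrite (ell_0 fs).
by apply: leq_ltn_trans IHk _; exact: (ell_mono fs).
Qed.

Lemma ell_gt0 k : (0 < ell k)%N.
Proof. exact: leq_ltn_trans (ell_gtn k). Qed.

(** Number of elements of the class of [i] that are at most [n]; [n + 1] candidates
    are enough because [k < ell k]. *)
Definition cnt (i n : nat) : nat :=
  find (fun k => n < i * ell k)%N (iota 0 n.+1).

Lemma ltn_cnt i n k : (0 < i)%N -> (k < cnt i n)%N = (i * ell k <= n)%N.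
Proof.
move=> i0; rewrite /cnt; set p := (fun k : nat => _).
have hp : has p (iota 0 n.+1).
  apply/hasP; exists n; rewrite ?mem_iota ?add0n//=.
  by rewrite /p /= (leq_trans (ell_gtn n))// leq_pmull.
have lt_find := hp; rewrite has_find size_iota in lt_find.
have := nth_find 0%N hp; rewrite /p nth_iota// add0n -/p => pfind.
apply/idP/idP => [kc|].
  have := before_find 0%N kc.
  by rewrite nth_iota ?(ltn_trans kc)// add0n /p ltnNge => /negbFE.
apply: contraLR; rewrite -leqNgt -ltnNge => ck.
by apply: leq_trans pfind _; rewrite leq_pmul2l// leq_ell.
Qed.

Lemma cnt_le i n N : (0 < i)%N -> (n <= N)%N -> (cnt i n <= cnt i N)%N.
Proof.
move=> i0 nN; rewrite leqNgt ltn_cnt//; apply/negP => /leq_trans/(_ nN).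
by rewrite -ltn_cnt// ltnn.
Qed.

Lemma cnt0 i n : (n < i)%N -> cnt i n = 0%N.
Proof.
move=> ni; apply/eqP; rewrite -leqn0 leqNgt ltn_cnt ?(leq_trans _ ni)//.
by rewrite (ell_0 fs) muln1 -ltnNge.
Qed.

Lemma eq_from_ltn a b : (forall k, (k < a)%N = (k < b)%N) -> a = b.
Proof.
move=> ab; apply/eqP; rewrite eqn_leq.
by rewrite leqNgt ab ltnn /= leqNgt -ab ltnn.
Qed.

Lemma cnt_exact i k n : cop i -> n.+1 = (i * ell k)%N -> cnt i n = k.
Proof.
move=> ci En; apply: eq_from_ltn => l; rewrite ltn_cnt ?(cop_gt0 fs)// -ltnS En.
by rewrite ltn_pmul2l ?(cop_gt0 fs)// ltn_ell.
Qed.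

(** Reading one more letter lengthens the word of exactly one class. *)
Lemma cntS i k i' n : cop i -> cop i' -> n.+1 = (i * ell k)%N ->
  cnt i' n.+1 = if i' == i then (cnt i' n).+1 else cnt i' n.
Proof.
move=> ci ci' En; apply: eq_from_ltn => l; rewrite ltn_cnt ?(cop_gt0 fs)//.
case: eqP => [->|ne].
  by rewrite ltnS (@cnt_exact i k)// En leq_pmul2l ?(cop_gt0 fs)// leq_ell.
rewrite ltn_cnt ?(cop_gt0 fs)// leq_eqVlt ltnS orb_idl// => /eqP.
by rewrite En => /(factor_uniq fs) [].
Qed.

(** The letters of [u] at the positions [i * ell 0, i * ell 1, ...].  Position [n]
    is stored at index [n - 1], and [cnt] keeps the indices in range, so the
    default letter [j0] is never read. *)
Definition subword (i : nat) (u : seq T) : seq T :=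
  mkseq (fun k => nth j0 u (i * ell k).-1) (cnt i (size u)).

Lemma size_subword i u : size (subword i u) = cnt i (size u).
Proof. exact: size_mkseq. Qed.

Lemma subword_mkseq (x : nat -> T) i n : (0 < i)%N ->
  subword i (mkseq x n) = mkseq (fun k => x (i * ell k).-1) (cnt i n).
Proof.
move=> i0; rewrite /subword size_mkseq; apply/eq_in_map => k.
rewrite mem_iota add0n /= ltn_cnt// => kn; rewrite nth_mkseq//.
by rewrite prednK// muln_gt0 i0 ell_gt0.
Qed.

Lemma subword_rcons i k i' (u : seq T) j :
  cop i -> cop i' -> (size u).+1 = (i * ell k)%N ->
  subword i' (rcons u j) =
  if i' == i then rcons (subword i' u) j else subword i' u.
Proof.
move=> ci ci' En; rewrite /subword size_rcons (@cntS i k)//.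
have old l : (l < cnt i' (size u))%N ->
    nth j0 (rcons u j) (i' * ell l).-1 = nth j0 u (i' * ell l).-1.
  rewrite ltn_cnt ?(cop_gt0 fs)// => hl; rewrite nth_rcons.
  by rewrite prednK ?hl// muln_gt0 ell_gt0 (cop_gt0 fs).
have oldE : mkseq (fun l => nth j0 (rcons u j) (i' * ell l).-1)
      (cnt i' (size u)) =
    mkseq (fun l => nth j0 u (i' * ell l).-1) (cnt i' (size u)).
  by apply/eq_in_map => l; rewrite mem_iota add0n; exact: old.
case: eqP => // Ei; rewrite mkseqS oldE; congr rcons.
by rewrite Ei (@cnt_exact i k)// -En /= nth_rcons ltnn eqxx.
Qed.

Section Product.
Context (R : realType).

(** The new letter is appended to the word of one class, the one of [i0], so
    summing over it affects one factor. *)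
Lemma sum_prod_rcons (h : nat -> seq T -> R) N i0 k0 (u : seq T) :
  cop i0 -> (size u).+1 = (i0 * ell k0)%N -> (size u < N)%N ->
  \sum_j \prod_(1 <= i < N.+1 | cop i) h i (subword i (rcons u j)) =
  \prod_(1 <= i < N.+1 | cop i)
    (if i == i0 then \sum_j h i (rcons (subword i u) j)
     else h i (subword i u)).
Proof.
move=> ci0 En uN.
have i0N : (1 <= i0 < N.+1)%N.
  by rewrite (cop_gt0 fs)//= ltnS (leq_trans _ uN)// En leq_pmulr ?ell_gt0.
have split1 (F : nat -> R) : \prod_(1 <= i < N.+1 | cop i) F i =
    F i0 * \prod_(1 <= i < N.+1 | cop i && (i != i0)) F i.
  rewrite (bigID (pred1 i0)) /=; congr (_ * _).
  rewrite (eq_bigl (pred1 i0)) => [|i /=]; first by rewrite big_nat1_eq i0N.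
  by rewrite andb_idl// => /eqP ->.
rewrite [RHS]split1 eqxx mulr_suml; apply: eq_bigr => j _.
rewrite split1 (@subword_rcons i0 k0)// eqxx; congr (_ * _).
apply: eq_bigr => i /andP[ci /negPf ne].
by rewrite (@subword_rcons i0 k0)// ne.
Qed.

(** The classes partition the positions, so their words vary independently.  The
    factors are arbitrary in order to let the induction replace one of them by its
    sum over the last letter. *)
Lemma sum_prod_classes (h : nat -> seq T -> R) N n : (n <= N)%N ->
  \sum_(u <- words T n) \prod_(1 <= i < N.+1 | cop i) h i (subword i u) =
  \prod_(1 <= i < N.+1 | cop i) \sum_(w <- words T (cnt i n)) h i w.
Proof.
elim: n h => [|n IHn] h nN.
  rewrite big_words0; apply: eq_bigr => i ci.
  by rewrite /subword cnt0 ?(cop_gt0 fs)// big_words0.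
have [i0 [k0 [ci0 En]]] := factor_ex fs (ltn0Sn n).
pose h' i w := if i == i0 then \sum_j h i (rcons w j) else h i w.
transitivity (\sum_(u <- words T n)
    \prod_(1 <= i < N.+1 | cop i) h' i (subword i u)); last first.
  rewrite IHn; last exact: ltnW.
  apply: eq_bigr => i ci; rewrite /h' (@cntS i0 k0)//.
  by case: eqP => // _; rewrite big_wordsS.
rewrite big_wordsS big_seq [RHS]big_seq; apply: eq_bigr => u.
rewrite mem_words => /eqP un.
by rewrite (@sum_prod_rcons h N i0 k0) ?un.
Qed.

End Product.
End Classes.

(** * The density of the class representatives *)

Definition ncop (cop : pred nat) (n : nat) : nat :=
  (\sum_(1 <= i < n.+1 | cop i) 1)%N.

Lemma ncop_le cop n : (ncop cop n <= n)%N.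
Proof.
rewrite /ncop sum1_count (leq_trans (count_size _ _))//.
by rewrite size_iota subn1.
Qed.

Section Counting.
Context (R : realType) (ell : nat -> nat) (cop : pred nat)
  (fs : factor_system ell cop).

Lemma sum_cnt N n : (n <= N)%N ->
  (\sum_(1 <= i < N.+1 | cop i) cnt ell i n)%N = n.
Proof.
elim: n => [|n IHn] nN.
  by apply: big1 => i ci; rewrite (cnt0 fs)// (cop_gt0 fs).
have [i0 [k0 [ci0 En]]] := factor_ex fs (ltn0Sn n).
have i0N : (1 <= i0 < N.+1)%N.
  rewrite (cop_gt0 fs)//= ltnS (leq_trans _ nN)// En leq_pmulr//.
  exact: ell_gt0 fs _.
transitivity (\sum_(1 <= i < N.+1 | cop i) (cnt ell i n + (i == i0)))%N.
  apply: eq_bigr => i ci; rewrite (cntS fs ci0 ci En).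
  by case: eqP; rewrite ?addn1 ?addn0.
rewrite big_split /= IHn ?(ltnW nN)// -[RHS]addn1; congr (_ + _)%N.
rewrite -big_mkcondr /= (eq_bigl (pred1 i0)) => [|i /=].
  by rewrite big_nat1_eq i0N.
by rewrite andb_idl// => /eqP ->.
Qed.

Lemma sum_ltn_cnt N n k : (n <= N)%N ->
  (\sum_(1 <= i < N.+1 | cop i) (k < cnt ell i n))%N = ncop cop (n %/ ell k).
Proof.
move=> nN; rewrite /ncop [RHS](big_nat_widen _ _ N.+1); last first.
  by rewrite ltnS; exact: leq_trans (leq_div _ _) nN.
rewrite -big_mkcondr /=; apply: eq_bigl => i.
case ci: (cop i) => //=; rewrite (ltn_cnt fs) ?(cop_gt0 fs)//.
by rewrite ltnS leq_divRL// (ell_gt0 fs).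
Qed.

(** Level [k] of the class of [i] is reached by the first [n] letters if and only
    if [i <= n / ell k]; this turns sums over classes into sums over levels. *)
Lemma sum_classes_trunc (h : nat -> R) K n N : (n <= N)%N ->
  \sum_(1 <= i < N.+1 | cop i) \sum_(k < minn (cnt ell i n) K) h k =
  \sum_(k < K) h k * (ncop cop (n %/ ell k))%:R.
Proof.
move=> nN; under [RHS]eq_bigr do rewrite -(sum_ltn_cnt _ nN).
under [RHS]eq_bigr do rewrite natr_sum mulr_sumr.
rewrite [RHS]exchange_big /=; apply: eq_bigr => i _.
rewrite (big_ord_widen_cond K predT) ?geq_minr// big_mkcond.
apply: eq_bigr => k _ /=; rewrite leq_min ltn_ord andbT.
by case: ltnP; rewrite ?mulr1 ?mulr0.
Qed.

Definition has_density (d C : R) : Prop :=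
  0 < d /\ forall n, `|(ncop cop n)%:R - d * n%:R| <= C.

Context (d C : R) (hd : has_density d C).

Lemma density_ge0 : 0 <= C.
Proof. exact: le_trans (hd.2 0). Qed.

Lemma ncop_div n l : (0 < l)%N ->
  `|(ncop cop (n %/ l))%:R - d * (n%:R / l%:R)| <= C + d.
Proof.
move=> l0; have [d0 hC] := hd.
rewrite (_ : _ - _ = (ncop cop (n %/ l))%:R - d * (n %/ l)%:R
    - d * (n%:R / l%:R - (n %/ l)%:R)); last by ring.
apply: le_trans (ler_normB _ _) _; apply: lerD => //.
rewrite normrM gtr0_norm// ler_piMr ?(ltW d0)//.
have l0' : 0 < l%:R :> R by rewrite ltr0n.
rewrite ger0_norm ?subr_ge0.
  rewrite lerBlDr ler_pdivrMr// -[1]/(1%:R) -natrD -natrM ler_nat.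
  by rewrite add1n ltnW// ltn_ceil.
by rewrite ler_pdivlMr// -natrM ler_nat leq_trunc_div.
Qed.

Lemma archi_le (a b c : R) : (forall n, (0 < n)%N -> a <= b + c / n%:R) ->
  a <= b.
Proof.
move=> h; apply/ler_addgt0Pr => e e0.
pose n := (Num.truncn (`|c| / e)).+1.
have n0 : 0 < n%:R :> R by rewrite ltr0n.
apply: le_trans (h n isT) _; rewrite lerD2l ler_pdivrMr//.
apply: le_trans (ler_norm c) _; rewrite mulrC -ler_pdivrMr// ltW//.
by have /andP[] := truncn_itv (divr_ge0 (normr_ge0 c) (ltW e0)).
Qed.

(** Count the integers up to [n] by their level: about [d * n / ell k] of them are
    at level [k], and the first [K] levels cannot hold more than [n]. *)
Lemma inv_sum_le K : \sum_(0 <= k < K) (ell k)%:R^-1 <= d^-1.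
Proof.
have [d0 hC] := hd.
rewrite -[leRHS]mul1r ler_pdivlMr// mulrC.
apply: (@archi_le _ _ (K%:R * (C + d))) => n n0.
have n0' : 0 < n%:R :> R by rewrite ltr0n.
rewrite -(ler_pM2r n0') mulrDl mul1r divfK ?gt_eqF//.
rewrite -lerBlDr; apply: le_trans (_ : \sum_(k < K)
   1 * (ncop cop (n %/ ell k))%:R <= _).
  have -> : K%:R * (C + d) = \sum_(k < K) (C + d).
    by rewrite sumr_const card_ord mulr_natl.
  rewrite big_mkord mulr_sumr mulr_suml -sumrB; apply: ler_sum => k _.
  have := ncop_div n (ell_gt0 fs k); rewrite ler_norml => /andP[+ _].
  by rewrite !mul1r -mulrA [_^-1 * _]mulrC lerBrDr addrC.
rewrite -(@sum_classes_trunc (fun=> 1) K n n)// -[leRHS](mulr_natr 1) mul1r.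
rewrite -[in leRHS](sum_cnt (leqnn n)) natr_sum; apply: ler_sum => i _.
by rewrite sumr_const card_ord ler_nat geq_minl.
Qed.

Lemma inv_sum_cvg K : cvgn (fun n => \sum_(K <= j < n) (ell j)%:R^-1 : R).
Proof.
apply: nondecreasing_is_cvgn.
  apply/nondecreasing_seqP => n; case: (leqP K n) => Kn.
    by rewrite big_nat_recr//= lerDl invr_ge0.
  by rewrite !big_geq// ltnW.
exists d^-1 => _ [n _ <-]; apply: le_trans (inv_sum_le n).
case: (leqP K n) => Kn.
  by rewrite (@big_cat_nat _ _ _ K 0)//= lerDr sumr_ge0 // => i _; rewrite invr_ge0.
by rewrite big_geq ?(ltnW Kn)// sumr_ge0 // => i _; rewrite invr_ge0.
Qed.

Lemma inv_sum_split K :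
  gamma R ell = \sum_(0 <= j < K) (ell j)%:R^-1 + inv_sum_from R ell K.
Proof.
rewrite /gamma /inv_sum_from; apply/cvg_lim => //.
have h := cvgD (@cvg_cst _ (\sum_(0 <= j < K) (ell j)%:R^-1 : R) nat \oo _)
  (@inv_sum_cvg K).
apply: (cvg_trans _ (h _ _)); apply: near_eq_cvg; near=> n.
rewrite /= fctE [RHS](@big_cat_nat _ _ _ K)//.
by near: n; exact: nbhs_infty_ge.
Unshelve. all: by end_near.
Qed.

Lemma inv_sum_from_ge0 K : 0 <= inv_sum_from R ell K.
Proof.
apply: limr_ge; first exact: inv_sum_cvg.
by near=> n; rewrite sumr_ge0 // => i _; rewrite invr_ge0.
Unshelve. all: by end_near.
Qed.

Lemma inv_sum_from_cvg0 : inv_sum_from R ell K @[K --> \oo] --> (0 : R).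
Proof.
rewrite -[0](subrr (gamma R ell)).
have -> : inv_sum_from R ell =
    (fun K => gamma R ell - \sum_(0 <= j < K) (ell j)%:R^-1).
  by apply/funext => K; rewrite (inv_sum_split K) addrC addKr.
by apply: cvgB; [exact: cvg_cst | exact: inv_sum_cvg].
Qed.

Lemma inv_sum_from_le K n :
  \sum_(K <= j < n) (ell j)%:R^-1 <= inv_sum_from R ell K.
Proof.
apply: nondecreasing_cvgn_le; last exact: inv_sum_cvg.
apply/nondecreasing_seqP => k; case: (leqP K k) => Kk.
  by rewrite big_nat_recr//= lerDl invr_ge0.
by rewrite !big_geq// ltnW.
Qed.

(** All levels together hold every integer once, so the densities [d / ell k] of
    the levels sum up to 1; the levels above [K] hold at most [n] times the tail
    of the series among the first [n] integers, which rules out an escape of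
    density. *)
Lemma gamma_density : gamma R ell = d^-1.
Proof.
have [d0 hC] := hd.
apply/eqP; rewrite eq_le; apply/andP; split.
  apply: limr_le; first exact: inv_sum_cvg.
  by near=> n; exact: inv_sum_le.
have main K : 1 <= d * gamma R ell + inv_sum_from R ell K.
  apply: (@archi_le _ _ (K%:R * (C + d))) => n n0.
  have n0' : 0 < n%:R :> R by rewrite ltr0n.
  rewrite -(ler_pM2r n0') mulrDl mul1r divfK ?gt_eqF//.
  have nE : n%:R = \sum_(0 <= k < n) (ncop cop (n %/ ell k))%:R :> R.
    rewrite big_mkord; transitivity (\sum_(k < n)
        1 * (ncop cop (n %/ ell k))%:R : R); last first.
      by apply: eq_bigr => k _; rewrite mul1r.
    rewrite -(@sum_classes_trunc (fun=> 1) n n n)// -[in LHS](sum_cnt (leqnn n)).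
    rewrite natr_sum; apply: eq_bigr => i ci.
    rewrite sumr_const card_ord; congr _%:R; apply/esym/minn_idPl.
    rewrite leqNgt (ltn_cnt fs) ?(cop_gt0 fs)// -ltnNge.
    by rewrite (leq_trans (ell_gtn fs n))// leq_pmull// (cop_gt0 fs).
  have hk k : (ncop cop (n %/ ell k))%:R <= (d / (ell k)%:R) * n%:R + (C + d).
    have := ncop_div n (ell_gt0 fs k); rewrite ler_norml => /andP[_].
    by rewrite lerBlDr addrC -mulrA [_^-1 * _]mulrC.
  have hk' k : (ncop cop (n %/ ell k))%:R <= (ell k)%:R^-1 * n%:R :> R.
    rewrite mulrC ler_pdivlMr ?ltr0n ?(ell_gt0 fs)// -natrM ler_nat.
    apply: leq_trans (leq_trunc_div n (ell k)).
    rewrite leq_pmul2r ?(ell_gt0 fs)//; exact: ncop_le.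
  rewrite [leLHS]nE (@big_cat_nat _ _ _ (minn K n)) ?geq_minr//= [X in _ <= X + _]mulrDl addrAC lerD//.
    apply: le_trans (_ : \sum_(0 <= k < minn K n)
      (d / (ell k)%:R * n%:R + (C + d)) <= _); first exact: ler_sum.
    rewrite big_split /= lerD//.
      rewrite -mulr_suml -mulr_sumr ler_wpM2r// ler_wpM2l ?(ltW d0)//.
      by rewrite (inv_sum_split (minn K n)) lerDl inv_sum_from_ge0.
    rewrite sumr_const_nat subn0 -[leLHS]mulr_natl ler_wpM2r ?ler_nat ?geq_minl//.
    by rewrite addr_ge0 ?density_ge0// ltW.
  apply: le_trans (_ : \sum_(minn K n <= k < n) (ell k)%:R^-1 * n%:R <= _).
    exact: ler_sum.
  rewrite -mulr_suml ler_wpM2r//.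
  case: (leqP K n) => Kn; first exact: inv_sum_from_le.
  by rewrite big_geq ?inv_sum_from_ge0.
rewrite -[leLHS]mul1r ler_pdivrMr// mulrC.
have h : d * gamma R ell + inv_sum_from R ell K @[K --> \oo] -->
    d * gamma R ell.
  rewrite -[X in _ --> X]addr0; apply: cvgD; first exact: cvg_cst.
  exact: inv_sum_from_cvg0.
rewrite -(cvg_lim (@Rhausdorff R) h); apply: limr_ge.
  by apply/cvg_ex; eexists; exact: h.
by near=> K; exact: main.
Unshelve. all: by end_near.
Qed.

End Counting.

(** * The semigroup generated by finitely many primes *)

Lemma pnat_gt0 (pi : nat_pred) n : pi.-nat n -> (0 < n)%N.
Proof. by case/andP. Qed.

Section PrimeSemigroup.
Context (J : nat) (p : 'I_J -> nat) (ell : nat -> nat)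
  (p_prime : forall j, prime (p j)) (ell_enum : increasing_enum (semigroup p) ell).

Definition coprime_to : pred nat :=
  fun i => (0 < i)%N && [forall j, ~~ (p j %| i)%N].

Let pi : nat_pred := [pred q | q \in codom p].

Lemma semigroup_pnat n : semigroup p n <-> pi.-nat n.
Proof.
split=> [[a ->]|].
  elim/big_ind: _ => // [x y px py|j _]; first by rewrite pnatM px.
  by rewrite pnatX pnatE ?p_prime// inE /= codom_f.
elim/ltn_ind: n => n IHn; case: (leqP n 1) => [n1 pn|n1 pn].
  exists (fun=> 0%N); rewrite big1//; apply/eqP.
  by rewrite eqn_leq n1 (pnat_gt0 pn).
have /pnatP := pn; move=> /(_ (ltnW n1)) /(_ _ (pdiv_prime n1) (pdiv_dvd n)).
rewrite inE => /codomP [j jE].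
have jn : (p j %| n)%N by rewrite -jE pdiv_dvd.
have pj := prime_gt1 (p_prime j).
have nE := divnK jn.
have [a aE] : semigroup p (n %/ p j)%N.
  apply: IHn; first by rewrite ltn_Pdiv// ltnW.
  by apply: pnat_dvd pn; rewrite dvdn_div.
exists (fun i => a i + (i == j))%N; rewrite -nE aE.
under [RHS]eq_bigr do rewrite expnD.
rewrite big_split /=; congr (_ * _)%N.
by rewrite (bigD1 j)//= eqxx big1 ?muln1// => i /negPf ->.
Qed.

Lemma coprime_to_pnat i : coprime_to i = (negn pi).-nat i.
Proof.
rewrite /coprime_to; case: (posnP i) => [->//|i0] /=.
apply/forallP/idP => [h|h j].
  apply/pnatP => // q qp qi; rewrite !inE; apply/negP => /codomP[j jE].
  by have := h j; rewrite -jE qi.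
apply/negP => ji; have /pnatP := h; move=> /(_ i0 _ (p_prime j) ji).
by rewrite !inE codom_f.
Qed.

(** Splitting an integer into its part at the primes [p j] and its part away from
    them. *)
Lemma prime_factor_system : factor_system ell coprime_to.
Proof.
have [mono rng] := ell_enum.
have Sell k : pi.-nat (ell k).
  by apply/semigroup_pnat; rewrite -rng; exists k.
have ellS n : pi.-nat n -> exists k, n = ell k.
  by move=> /semigroup_pnat; rewrite -rng => -[k _ <-]; exists k.
have lmono := leq_mono mono.
split=> //.
- by move=> i /andP[].
- have [k] := ellS 1%N isT; case: k => [//|k] k1.
  have := mono 0%N k.+1 isT; rewrite -k1 ltnS leqn0 => /eqP e0.
  by have := pnat_gt0 (Sell 0%N); rewrite e0.
- move=> n n0; have [k kE] := ellS _ (part_pnat pi n).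
  exists (n`_(negn pi))%N, k; rewrite coprime_to_pnat part_pnat; split=> //.
  by rewrite -kE mulnC partnC.
- move=> i i' k k'; rewrite !coprime_to_pnat => ci ci' E.
  have part a l : (negn pi).-nat a -> ((a * ell l)`_pi)%N = ell l.
    move=> ca; rewrite partnM ?(pnat_gt0 ca) ?(pnat_gt0 (Sell l))//.
    by rewrite part_p'nat// mul1n part_pnat_id.
  have ek : ell k = ell k' by rewrite -(part i)// E part.
  have -> : k = k' by apply: (incn_inj lmono).
  split=> //; apply/eqP; rewrite -(eqn_pmul2r (pnat_gt0 (Sell k))) E ek.
  by rewrite eqxx.
Qed.

Lemma ncopS cop n : ncop cop n.+1 = (ncop cop n + cop n.+1)%N.
Proof. by rewrite /ncop big_mkcond big_nat_recr//= -big_mkcond; case: ifP. Qed.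

(** Coprimality to the [p j] is periodic modulo their product, and the number of
    representatives in a period is positive because 1 is one of them. *)
Lemma prime_density (R : realType) : exists d C : R, has_density coprime_to d C.
Proof.
pose Q := (\prod_j p j)%N; pose D := ncop coprime_to Q.
have Q0 : (0 < Q)%N by apply: prodn_gt0 => j; rewrite prime_gt0.
have per n : coprime_to (n.+1 + Q) = coprime_to n.+1.
  rewrite /coprime_to addn_gt0 /=; apply: eq_forallb => j.
  by rewrite dvdn_addl// /Q (bigD1 j)//= dvdn_mulr.
have ncopQ n : ncop coprime_to (n + Q) = (ncop coprime_to n + D)%N.
  elim: n => [|n IHn]; first by rewrite add0n [ncop _ 0]/ncop big_geq.
  by rewrite addSn !ncopS IHn -addSn per addnAC.
have ncopM q r : ncop coprime_to (q * Q + r) = (q * D + ncop coprime_to r)%N.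
  elim: q => [|q IHq]; first by rewrite !mul0n.
  by rewrite mulSn -addnA addnC ncopQ IHq mulSn addnC addnA.
have Q0' : 0 < Q%:R :> R by rewrite ltr0n.
have D0 : (0 < D)%N.
  rewrite /D -(prednK Q0) /ncop big_ltn_cond// ifT//.
  by apply/andP; split=> //; apply/forallP => j; rewrite dvdn1 gtn_eqF ?prime_gt1.
have DQ : (D <= Q)%N by exact: ncop_le.
exists (D%:R / Q%:R), Q%:R; split=> [|n]; first by rewrite divr_gt0 ?ltr0n.
rewrite (divn_eq n Q) ncopM; set q := (n %/ Q)%N; set r := (n %% Q)%N.
have -> : (q * D + ncop coprime_to r)%:R - D%:R / Q%:R * (q * Q + r)%:R =
    (ncop coprime_to r)%:R - D%:R / Q%:R * r%:R :> R.
  by rewrite !natrD !natrM; field; rewrite gt_eqF.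
have rQ : (r < Q)%N by rewrite ltn_mod.
have a0 : 0 <= D%:R / Q%:R * r%:R :> R by rewrite mulr_ge0// divr_ge0.
have aQ : D%:R / Q%:R * r%:R <= Q%:R :> R.
  rewrite -mulrA [_^-1 * _]mulrC mulrA ler_pdivrMr// -!natrM ler_nat.
  by rewrite leq_mul// ltnW.
have n0 : 0 <= (ncop coprime_to r)%:R :> R by [].
have nQ : (ncop coprime_to r)%:R <= Q%:R :> R.
  by rewrite ler_nat (leq_trans (ncop_le _ _))// ltnW.
by rewrite ler_norml; apply/andP; split; lra.
Qed.

End PrimeSemigroup.

(** * The product mass *)

Section ProductMass.
Context (R : realType) (T : finType) (j0 : T) (A : pred (seq T))
  (f : seq T -> R) (e : nat -> R) (ts : tree_system A f e)
  (ell : nat -> nat) (cop : pred nat) (fs : factor_system ell cop).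

Local Notation trace := (subword j0 ell).
Local Notation cnt := (cnt ell).

Definition mass (u : seq T) : R :=
  \prod_(1 <= i < (size u).+1 | cop i) weight A f e (trace i u).

Definition logmass (u : seq T) : R :=
  \sum_(1 <= i < (size u).+1 | cop i) logw f e (trace i u).

Definition admissible (u : seq T) : Prop :=
  forall i, cop i -> A (trace i u).

Lemma subword_short u i : (size u < i)%N -> trace i u = [::].
Proof. by move=> ui; rewrite /subword (cnt0 fs ui). Qed.

(** Classes beyond the length of the word carry the empty word, of weight 1. *)
Lemma mass_widen N u : (size u <= N)%N ->
  mass u = \prod_(1 <= i < N.+1 | cop i) weight A f e (trace i u).
Proof.
move=> uN; rewrite /mass [RHS](@big_cat_nat _ _ _ (size u).+1)//=.
rewrite [X in _ = _ * X]big_nat_cond [X in _ = _ * X]big1 ?mulr1// => i.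
by move=> /andP[/andP[ui _] _]; rewrite subword_short// (weight_nil ts).
Qed.

Lemma mass_ge0 u : 0 <= mass u.
Proof. by apply: prodr_ge0 => i _; exact: weight_ge0. Qed.

Lemma mass_expR u : admissible u -> mass u = expR (logmass u).
Proof.
move=> adm; rewrite /mass /logmass expR_sum; apply: eq_bigr => i ci.
by rewrite /weight adm.
Qed.

Lemma mass_gt0 u : 0 < mass u -> admissible u.
Proof.
move=> m0 i ci; case: (leqP i (size u)) => iu; last first.
  by rewrite subword_short// (tree_nil ts).
apply/negP => /negP nA; move: m0; rewrite /mass (bigID (pred1 i)) /=.
rewrite (eq_bigl (pred1 i)) => [|k /=]; last first.
  by rewrite andb_idl// => /eqP ->.
rewrite big_nat1_eq ltnS iu (cop_gt0 fs)//= /weight (negPf nA) mul0r.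
by rewrite ltxx.
Qed.

Lemma sum_mass_rcons u : \sum_j mass (rcons u j) = mass u.
Proof.
have [i0 [k0 [ci0 En]]] := factor_ex fs (ltn0Sn (size u)).
rewrite (@mass_widen (size u).+1 u)//.
under [LHS]eq_bigr do rewrite (@mass_widen (size u).+1) ?size_rcons//.
rewrite (sum_prod_rcons j0 fs (fun=> weight A f e) ci0 En)//.
apply: eq_bigr => i _; case: eqP => // _; exact: sum_weight_rcons.
Qed.

Lemma sum_mass n : \sum_(u <- words T n) mass u = 1.
Proof.
elim: n => [|n IHn]; last first.
  by rewrite big_wordsS; under eq_bigr do rewrite sum_mass_rcons.
by rewrite big_words0 /mass big_geq.
Qed.

(** Independence of the classes. *)
Lemma sum_mass_expR lam n :
  \sum_(u <- words T n) mass u * expR (lam * logmass u) =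
  \prod_(1 <= i < n.+1 | cop i) mgf A f e lam (cnt i n).
Proof.
rewrite /mgf -(sum_prod_classes j0 fs
  (fun i w => weight A f e w * expR (lam * logw f e w)) (leqnn n)).
rewrite big_seq [RHS]big_seq; apply: eq_bigr => u; rewrite mem_words => /eqP un.
rewrite /mass /logmass un mulr_sumr expR_sum -big_split /=.
by [].
Qed.

Hypotheses (e_0 : e 0 = gamma R ell)
  (e_S : forall k, e k.+1 = (ell k.+1)%:R / (ell k)%:R).
Context (d C : R) (hd : has_density cop d C).

Local Notation f0 := (f [::]).

Lemma gamma_ncop_le n : gamma R ell * (ncop cop n)%:R <= n%:R + C / d.
Proof.
rewrite (gamma_density fs hd); have [d0 /(_ n)] := hd.
rewrite ler_norml => /andP[_ h].
rewrite mulrC ler_pdivrMr// mulrDl divfK ?gt_eqF//.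
by rewrite mulrC -lerBlDl.
Qed.

Lemma ell_gt0R k : 0 < (ell k)%:R :> R.
Proof. by rewrite ltr0n (ell_gt0 fs). Qed.

(** * Words of large mass along a point *)

(** The coefficient of level 0 is 0 here because the value of [f] at the empty word
    is the main term of the local dimension.  Exchanging the sums replaces the
    weights by their tails [1 / (i * ell l) - 1 / (N + 1)]; since
    [e l / ell l = 1 / ell l.-1] for [l > 0], the main parts of the coefficients of a value
    [g l] cancel, and what the cut at [N] leaves is nonpositive. *)
Lemma class_average (g : nat -> R) N i : (forall l, 0 <= g l) -> (0 < i)%N ->
  \sum_(1 <= n < N.+1) (n%:R^-1 - n.+1%:R^-1) *
    (\sum_(l < cnt i n) ((if l == 0 :> nat then 0 else e l) * g l - g l.+1))
  <= 0.
Proof.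
move=> g0 i0; set D := fun l : nat => (if l == 0%N then 0 else e l) * g l - g l.+1.
set w := fun n : nat => n%:R^-1 - n.+1%:R^-1 : R.
have i0' : 0 < i%:R :> R by rewrite ltr0n.
have -> : \sum_(1 <= n < N.+1) w n * \sum_(l < cnt i n) D l =
    \sum_(l < cnt i N) D l * ((i * ell l)%:R^-1 - N.+1%:R^-1).
  transitivity (\sum_(1 <= n < N.+1) \sum_(l < cnt i N)
      D l * (if (i * ell l <= n)%N then w n else 0)).
    apply: eq_big_nat => n /andP[_ nN]; rewrite mulr_sumr.
    rewrite (big_ord_widen (cnt i N) (fun l => w n * D l)); last first.
      by apply: (cnt_le fs) => //; rewrite -ltnS.
    rewrite big_mkcond; apply: eq_bigr => l _; rewrite (ltn_cnt fs)//.
    by case: ifP; rewrite ?mulr0// mulrC.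
  rewrite exchange_big /=; apply: eq_bigr => l _; rewrite -mulr_sumr; congr (_ * _).
  have lN : (i * ell l <= N)%N by rewrite -(ltn_cnt fs).
  have l1 : (0 < i * ell l)%N by rewrite muln_gt0 i0 (ell_gt0 fs).
  rewrite -big_mkcond (@big_cat_nat _ _ _ (i * ell l)) ?(leq_trans lN)//=.
  rewrite big_nat_cond big1 ?add0r => [|n]; last first.
    by case/andP => /andP[_]; rewrite ltnNge => /negPf ->.
  transitivity (\sum_(i * ell l <= n < N.+1) (- n.+1%:R^-1 - - n%:R^-1 : R)).
    rewrite big_nat_cond [RHS]big_nat_cond; apply: eq_big => [n|n _].
      by case: (i * ell l <= n)%N.
    by rewrite /w opprK addrC.
  rewrite (telescope_sumr (fun n => - n%:R^-1 : R)) ?(leq_trans lN)//.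
  by rewrite opprK addrC.
(* Partial sums: the last value [g k] still waits for its compensation. *)
have {w}: forall k, (k <= cnt i N)%N ->
    \sum_(l < k) D l * ((i * ell l)%:R^-1 - N.+1%:R^-1) <=
    if k is k'.+1 then - g k * ((i * ell k')%:R^-1 - N.+1%:R^-1) else 0.
  elim=> [|k IHk] kc; first by rewrite big_ord0.
  rewrite big_ord_recr /= (le_trans (lerD (IHk (ltnW kc)) (lexx _)))//.
  case: k kc {IHk} => [|k] kc; first by rewrite /D /= mul0r !add0r.
  rewrite /D /= e_S.
  set u := (i * ell k.+1)%:R^-1; set v := (i * ell k)%:R^-1.
  have uv : (ell k.+1)%:R / (ell k)%:R * u = v.
    rewrite /u /v !natrM; field.
    by rewrite !gt_eqF ?ell_gt0R.
  set r := _ / _ in uv *.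
  have r1 : 1 <= r.
    by rewrite ler_pdivlMr ?ell_gt0R// mul1r ler_nat (leq_ell fs).
  have gk := g0 k.+1; set z := N.+1%:R^-1.
  have z0 : 0 <= z by rewrite /z invr_ge0.
  rewrite -subr_ge0.
  have -> : - g k.+2 * (u - z) - (- g k.+1 * (v - z) + (r * g k.+1 - g k.+2) * (u - z)) =
     g k.+1 * (v - r * u) + g k.+1 * z * (r - 1) by ring.
  rewrite uv subrr mulr0 add0r; apply: mulr_ge0; last by rewrite subr_ge0.
  exact: mulr_ge0.
move=> /(_ _ (leqnn _)) h; apply: le_trans h _.
case E : (cnt i N) => [//|k].
rewrite mulNr oppr_le0 mulr_ge0// subr_ge0.
have kN : (i * ell k <= N)%N by rewrite -(ltn_cnt fs)// E.
rewrite lef_pV2 ?posrE ?ltr0n ?muln_gt0 ?i0 ?(ell_gt0 fs)// ler_nat.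
exact: leq_trans kN _.
Qed.

Section Point.
Context (x : nat -> T).
Hypothesis x_adm : forall i k, cop i ->
  A (mkseq (fun l => x (i * ell l).-1) k).

Let g (i k : nat) : R := f (mkseq (fun l => x (i * ell l).-1) k).

Lemma point_admissible n : admissible (mkseq x n).
Proof. by move=> i ci; rewrite (subword_mkseq _ fs) ?(cop_gt0 fs)// x_adm. Qed.

Lemma logmass_point n N : (n <= N)%N -> logmass (mkseq x n) =
  - \sum_(1 <= i < N.+1 | cop i) \sum_(l < cnt i n) (e l * g i l - g i l.+1).
Proof.
move=> nN; rewrite [in RHS](@big_cat_nat _ _ _ n.+1)//= [X in - (_ + X)]big_nat_cond.
rewrite [X in - (_ + X)]big1 => [|i]; last first.
  by move=> /andP[/andP[ni _] _]; rewrite (cnt0 fs)// big_ord0.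
rewrite addr0 -sumrN /logmass size_mkseq; apply: eq_bigr => i ci.
rewrite (subword_mkseq _ fs) ?(cop_gt0 fs)// /logw size_mkseq -sumrN.
apply: eq_bigr => l _; rewrite opprB /g /mkseq -!map_take !take_iota.
by rewrite (minn_idPl (ltn_ord l)) (minn_idPl (ltnW (ltn_ord l))).
Qed.

Lemma logmass_average N :
  \sum_(1 <= n < N.+1) (n%:R^-1 - n.+1%:R^-1) *
    (- logmass (mkseq x n) - f0 * (gamma R ell * (ncop cop n)%:R)) <= 0.
Proof.
rewrite (_ : \sum_(1 <= n < N.+1) _ =
    \sum_(1 <= i < N.+1 | cop i) \sum_(1 <= n < N.+1)
    (n%:R^-1 - n.+1%:R^-1) * (\sum_(l < cnt i n)
      ((if l == 0 :> nat then 0 else e l) * g i l - g i l.+1))); last first.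
  rewrite exchange_big /=; apply: eq_big_nat => n; rewrite ltnS => /andP[_ nN].
  rewrite -mulr_sumr; congr (_ * _); rewrite (@logmass_point n N)// opprK.
  rewrite -[n in ncop _ n]divn1 -[in (n %/ _)%N](ell_0 fs).
  rewrite -(sum_ltn_cnt fs _ nN) natr_sum !mulr_sumr -sumrB.
  apply: eq_bigr => i ci; case: (cnt i n) => [|k].
    by rewrite !big_ord0 !mulr0 subrr.
  rewrite !big_ord_recl /= e_0 mul0r mulr1 [g i 0]/g /=.
  by rewrite addrAC; congr (_ + _); rewrite mulrC addrAC subrr.
apply: sumr_le0 => i ci; apply: class_average; last exact: cop_gt0 fs _ ci.
by move=> l; apply: (tree_ge0 ts); exact: x_adm.
Qed.

(** Otherwise the nonpositive average of [logmass_average] would dominate the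
    harmonic series. *)
Lemma mass_large_infinitely_often (eps : R) n0 : 0 < eps ->
  exists2 n, (n0 <= n)%N & expR (- n%:R * (f0 + eps)) <= mass (mkseq x n).
Proof.
move=> eps0; apply: contrapT => hno.
have small n : (n0 <= n)%N -> logmass (mkseq x n) <= - n%:R * (f0 + eps).
  move=> n0n; rewrite leNgt; apply/negP => lt; apply: hno; exists n => //.
  by rewrite (mass_expR (@point_admissible n)) ler_expR ltW.
have f00 : 0 <= f0 by apply: (tree_ge0 ts); exact: tree_nil ts.
pose a n : R := - logmass (mkseq x n) - f0 * (gamma R ell * (ncop cop n)%:R).
pose w n : R := n%:R^-1 - n.+1%:R^-1.
(* From [n2] on, half of [eps] absorbs the bounded error in the number of
   classes. *)
pose n2 := (Num.truncn (f0 * (C / d) / (eps / 2))).+1.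
pose n1 := maxn n0 n2.
have wE n : (0 < n)%N -> w n * n%:R = n.+1%:R^-1.
  move=> n0'; rewrite /w; field.
  by rewrite nat1r !pnatr_eq0 /= -lt0n n0'.
have w0 n : (0 < n)%N -> 0 <= w n.
  by move=> n0'; rewrite subr_ge0 lef_pV2 ?posrE ?ltr0n// ler_nat.
have low n : (n1 <= n)%N -> eps / 2 * n.+1%:R^-1 <= w n * a n.
  rewrite geq_max => /andP[n0n n2n].
  have n0' : (0 < n)%N by exact: leq_trans n2n.
  rewrite -[n.+1%:R^-1]wE// mulrCA ler_wpM2l ?w0// /a.
  have h1 := small n n0n.
  have h2 : f0 * (gamma R ell * (ncop cop n)%:R) <= f0 * (n%:R + C / d).
    by rewrite ler_wpM2l// gamma_ncop_le.
  have h3 : f0 * (C / d) <= eps / 2 * n%:R.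
    rewrite [leRHS]mulrC -ler_pdivrMr ?divr_gt0//.
    have := truncn_itv (divr_ge0 (mulr_ge0 f00 (divr_ge0 (density_ge0 hd)
      (ltW hd.1))) (ltW (divr_gt0 eps0 (@ltr0Sn R 1)))).
    by move=> /andP[_ /ltW/le_trans]; apply; rewrite ler_nat.
  move: h1 h2 h3; set c := C / d; set q := gamma R ell * _.
  set L := logmass _; move=> h1 h2 h3; nra.
apply: (@dvg_harmonic R); apply: nondecreasing_is_cvgn.
  apply/nondecreasing_seqP => n; rewrite /series /= big_nat_recr//= lerDl.
  by rewrite /harmonic /= invr_ge0.
exists (\sum_(0 <= n < n1.+1) n.+1%:R^-1 +
  (eps / 2)^-1 * - (\sum_(1 <= n < n1.+1) w n * a n)).
move=> _ [N _ <-]; rewrite /series /=.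
apply: le_trans (_ : \sum_(0 <= n < (n1 + N).+1) n.+1%:R^-1 <= _).
  rewrite [leRHS](@big_cat_nat _ _ _ N) ?(leqW (leq_addl _ _))//=.
  by rewrite lerDl sumr_ge0 // => k _; rewrite invr_ge0.
rewrite (@big_cat_nat _ _ _ n1.+1) ?ltnS ?leq_addr//= lerD2l.
have e2 : 0 < eps / 2 by rewrite divr_gt0.
rewrite mulrC ler_pdivlMr// mulrC mulr_sumr.
have := logmass_average (n1 + N); rewrite -/(a _).
rewrite (@big_cat_nat _ _ _ n1.+1) ?ltnS ?leq_addr//= => h.
rewrite -subr_le0 opprK addrC; apply: le_trans h; rewrite lerD2l.
rewrite big_nat_cond [leRHS]big_nat_cond; apply: ler_sum => n /andP[/andP[h _] _].
by apply: low; exact: ltnW.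
Qed.

End Point.
End ProductMass.

(** * Words of exceptionally large mass *)

Section LargeDeviation.
Context (R : realType) (T : finType) (j0 : T) (A : pred (seq T))
  (f : seq T -> R) (e : nat -> R) (ts : tree_system A f e)
  (ell : nat -> nat) (cop : pred nat) (fs : factor_system ell cop).
Hypotheses (e_0 : e 0 = gamma R ell)
  (e_S : forall k, e k.+1 = (ell k.+1)%:R / (ell k)%:R).
Context (d C : R) (hd : has_density cop d C).

Context (b : R) (b_ge0 : 0 <= b).
Hypothesis f_le : forall w k, A w -> size w = k.+1 ->
  f w <= b * ((ell k)%:R * inv_sum_from R ell k.+1).

Local Notation f0 := (f [::]).
Local Notation phi := (mean_f A f e).
Local Notation entropy := (entropy A f e).
Local Notation mass := (mass j0 A f e ell cop).
Local Notation logmass := (logmass j0 f e ell cop).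

Lemma mean_f_le k :
  phi k.+1 <= b * ((ell k)%:R * inv_sum_from R ell k.+1).
Proof.
rewrite -[leRHS]mul1r -[X in _ <= X * _](sum_weight ts k.+1) mulr_suml /mean_f.
rewrite big_seq [leRHS]big_seq; apply: ler_sum => w; rewrite mem_words => /eqP wk.
rewrite /weight; case: ifPn => Aw; last by rewrite !mul0r.
by rewrite ler_wpM2l ?expR_ge0// f_le.
Qed.

(** For [j > 0], [mean_f j] occurs with coefficient [e j / ell j] from the term of
    index [j] and [- 1 / ell j.-1] from the previous one, and these are
    opposite. *)
Lemma entropy_telescope K :
  \sum_(j < K.+1) (e j * phi j - phi j.+1) * (ell j)%:R^-1 =
  gamma R ell * f0 - phi K.+1 / (ell K)%:R.
Proof.
elim: K => [|K IHK].
  rewrite big_ord1 e_0 (ell_0 fs) invr1 !mulr1; congr (_ * _ - _).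
  by rewrite /mean_f big_words0 (weight_nil ts) mul1r.
rewrite big_ord_recr /= IHK e_S; field.
by rewrite !gt_eqF ?(ell_gt0R _ fs).
Qed.

Lemma entropy_density K :
  f0 - d * b * inv_sum_from R ell K.+1 <=
  d * \sum_(j < K.+1) (e j * phi j - phi j.+1) * (ell j)%:R^-1.
Proof.
have [d0 _] := hd.
rewrite entropy_telescope mulrBr (gamma_density fs hd) mulrA mulfV ?gt_eqF//.
rewrite mul1r lerD2l lerN2 -mulrA ler_wpM2l ?(ltW d0)//.
rewrite ler_pdivrMr ?(ell_gt0R _ fs)//.
by rewrite -mulrA [_ * (ell K)%:R]mulrC mean_f_le.
Qed.

(** Markov's inequality: on the words of the left-hand sum,
    [lam * (logmass u + n * a)] is nonnegative. *)
Lemma sum_large_mass_le lam a n : 0 <= lam ->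
  \sum_(u <- words T n | expR (- n%:R * a) < mass u) mass u <=
  expR (lam * n%:R * a) * \prod_(1 <= i < n.+1 | cop i) mgf A f e lam (cnt ell i n).
Proof.
move=> lam0; rewrite -(sum_mass_expR j0 A f e fs) mulr_sumr big_mkcond.
apply: ler_sum => u _; case: ifPn => [hu|_]; last first.
  by rewrite mulr_ge0 ?mulr_ge0 ?expR_ge0 ?mass_ge0.
rewrite mulrCA -[leLHS]mulr1 ler_wpM2l ?mass_ge0// -expRD -[leLHS]expR0 ler_expR.
have adm := mass_gt0 ts fs (lt_trans (expR_gt0 _) hu).
move: hu; rewrite (mass_expR f e adm) ltr_expR => /ltW h.
by rewrite -mulrA -mulrDr mulr_ge0// -lerBlDl sub0r -mulNr.
Qed.

(** The level [K] is chosen first, so that the truncated entropy is close to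
    [f [::]]; then [lam], so that the second order term of the moments is small
    compared with the first order one. *)
Lemma sum_large_mass_geometric eps : 0 < eps ->
  exists c q : R, [/\ 0 <= c, 0 < q < 1 & forall n,
    \sum_(u <- words T n | expR (- n%:R * (f0 - eps)) < mass u) mass u
    <= c * q ^+ n].
Proof.
move=> eps0; have [d0 _] := hd.
have [K hK] : exists K, d * b * inv_sum_from R ell K.+1 <= eps / 3.
  have db : 0 < d * b + 1 by rewrite ltr_wpDl// mulr_ge0// ltW.
  have eps' : 0 < eps / 3 / (d * b + 1) by rewrite !divr_gt0.
  have /cvgrPdist_le/(_ _ eps') [N _ hN] := inv_sum_from_cvg0 fs hd.
  exists N; have := hN N.+1 (leqnSn N); rewrite sub0r normrN.
  rewrite ger0_norm ?(inv_sum_from_ge0 fs hd)// ler_pdivlMr// mulrC.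
  apply: le_trans; rewrite ler_wpM2r ?(inv_sum_from_ge0 fs hd)//.
  by rewrite lerDl.
pose h j := e j * phi j - phi j.+1.
pose M2 k := \sum_(w <- words T k) weight A f e w * logw f e w ^+ 2.
have M2_ge0 k : 0 <= M2 k.
  by apply: sumr_ge0 => w _; rewrite mulr_ge0 ?weight_ge0 ?sqr_ge0.
pose M := \sum_(k < K.+2) M2 k.
have M0 : 0 <= M by exact: sumr_ge0.
have M2_le k : (k <= K.+1)%N -> M2 k <= M.
  move=> kK; rewrite /M (bigD1 (Ordinal (kK : k < K.+2)%N))//= lerDl.
  exact: sumr_ge0.
pose lam := eps / 3 / (M + 1).
have M1 : 0 < M + 1 by rewrite ltr_wpDl.
have lam0 : 0 < lam by rewrite !divr_gt0.
have lamM : lam * M <= eps / 3.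
  rewrite /lam mulrAC ler_pdivrMr// ler_wpM2l ?divr_ge0 ?(ltW eps0)//.
  by rewrite lerDl.
pose C2 := (C + d) * \sum_(j < K.+1) `|h j|.
exists (expR (lam * C2)), (expR (- (lam * (eps / 3)))); split.
- exact: expR_ge0.
- rewrite expR_gt0 -[ltRHS]expR0 ltr_expR oppr_lt0 mulr_gt0//.
  by rewrite divr_gt0.
move=> n; apply: le_trans (sum_large_mass_le _ _ (ltW lam0)) _.
rewrite -expRM_natl -expRD.
apply: le_trans (_ : expR (lam * n%:R * (f0 - eps)) *
  expR (- lam * (\sum_(j < K.+1) h j * (ncop cop (n %/ ell j))%:R)
        + lam ^+ 2 * M * n%:R) <= _).
  rewrite ler_wpM2l ?expR_ge0//.
  apply: le_trans (_ : \prod_(1 <= i < n.+1 | cop i)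
    expR (- lam * entropy (minn (cnt ell i n) K.+1) + lam ^+ 2 * M) <= _).
    apply: ler_prod => i ci; rewrite mgf_ge0//=.
    apply: le_trans (mgf_le ts _ K.+1 (ltW lam0)) _.
    apply: le_trans (mgf_entropy ts _ (ltW lam0)) _.
    by rewrite ler_expR lerD2l ler_wpM2l ?sqr_ge0// M2_le// geq_minr.
  rewrite -expR_sum ler_expR big_split /=; apply: lerD.
    rewrite -mulr_sumr; under [in leLHS]eq_bigr do rewrite (entropy_sum ts).
    by rewrite (sum_classes_trunc fs h _ (leqnn n)).
  apply: le_trans (_ : \sum_(1 <= i < n.+1) lam ^+ 2 * M <= _).
    rewrite big_mkcond; apply: ler_sum => i _; case: ifP => // _.
    by rewrite mulr_ge0 ?sqr_ge0.
  by rewrite sumr_const_nat subn1 mulr_natr.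
rewrite -expRD ler_expR.
have lowh : n%:R * (f0 - eps / 3) - C2 <=
    \sum_(j < K.+1) h j * (ncop cop (n %/ ell j))%:R.
  apply: le_trans (_ : \sum_(j < K.+1) (n%:R * (d * (h j * (ell j)%:R^-1))
      - (C + d) * `|h j|) <= _); last first.
    apply: ler_sum => j _.
    have := ncop_div hd n (ell_gt0 fs j).
    set y := (ncop _ _)%:R => hy.
    rewrite -subr_ge0.
    have -> : h j * y - (n%:R * (d * (h j * (ell j)%:R^-1)) - (C + d) * `|h j|) =
      (C + d) * `|h j| + h j * (y - d * (n%:R / (ell j)%:R)) by ring.
    rewrite -lerBlDl sub0r; apply: lerNnormlW.
    by rewrite normrM mulrC ler_wpM2r.
  rewrite sumrB -!mulr_sumr lerD2r ler_wpM2l//.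
  by apply: le_trans (entropy_density K); rewrite lerD2l lerN2.
have n0 : 0 <= n%:R :> R by [].
have hlam := ler_wpM2l (ltW lam0) lowh.
have hM : lam ^+ 2 * M * n%:R <= lam * (eps / 3) * n%:R.
  by rewrite ler_wpM2r// expr2 -mulrA ler_wpM2l// ltW.
by nra.
Qed.

End LargeDeviation.

(** * Topology of the symbolic space *)

Lemma reindex_continuous (T : topologicalType) (g : nat -> nat) :
  continuous (fun x : prod_topology (fun _ : nat => T) =>
    (fun k => x (g k)) : prod_topology (fun _ : nat => T)).
Proof.
pose F (x : prod_topology (fun _ : nat => T)) : prod_topology (fun _ : nat => T) := fun k => x (g k).
move=> x; change (F @ x --> F x).
apply/cvg_sup; first exact/fmap_filter/nbhs_filter.
move=> k; move: x.
apply/(@continuousP _ (initial_topology (@^~ k))) => _ [B oB <-].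
have -> : F @^-1` (@^~ k @^-1` B) = proj (g k) @^-1` B by [].
by apply: open_comp => // x _; exact: proj_continuous.
Qed.

Section Topology.
Context (m : nat).

Lemma open_cylinder (u : seq 'I_m) : open (cylinder u : set (Sigma m)).
Proof.
elim/last_ind: u => [|u j IHu].
  have -> : cylinder ([::] : seq 'I_m) = setT by apply/seteqP; split.
  exact: openT.
rewrite (_ : cylinder _ = cylinder u `&`
    (fun x : Sigma m => (x (size u) : discrete_topology 'I_m)) @^-1` [set j]).
  apply: openI => //; apply: open_comp; last exact: discrete_open.
  by move=> x _; exact: proj_continuous.
apply/seteqP; split=> x; rewrite /cylinder /= size_rcons mkseqS.
  by move=> /rcons_inj [-> ->].
by move=> [-> ->].
Qed.

Lemma compact_Sigma : compact [set: Sigma m].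
Proof.
have := @tychonoff nat (fun=> discrete_topology 'I_m) (fun=> setT).
rewrite (_ : [set f | _] = setT); last by apply/seteqP; split.
apply=> _; apply: finite_compact; exact: finite_finset.
Qed.

Lemma restr_continuous (ell : nat -> nat) i : continuous (@restr m ell i).
Proof. exact: reindex_continuous. Qed.

Lemma compact_X_set (J : nat) (p : 'I_J -> nat) ell (Omega : set (Sigma m)) :
  closed Omega -> compact (X_set p ell Omega).
Proof.
move=> cO; apply: subclosed_compact compact_Sigma _ => //.
rewrite (_ : X_set _ _ _ = \bigcap_(i in [set i : nat | (0 < i)%N /\
    forall j, ~~ (p j %| i)%N]) (@restr m ell i) @^-1` Omega).
  apply: closed_bigI => i _; apply: preimage_closed => //.
  by move=> x _; exact: restr_continuous.
apply/seteqP; split=> x; first by move=> Xx i [i0 ip]; exact: Xx.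
by move=> Xx i i0 ip; apply: Xx.
Qed.

(** Cylinders are open and [N] may grow, so this is compactness in its form for
    monotone covers. *)
Lemma compact_cylinders (X : set (Sigma m)) (c : nat -> seq 'I_m) :
  compact X -> X `<=` \bigcup_n cylinder (c n) ->
  exists N, X `<=` [set x | exists2 n, (n < N)%N & cylinder (c n) x].
Proof.
move=> /compact_near_coveringP cX Xc.
have := cX nat \oo (fun N x => exists2 n, (n < N)%N & cylinder (c n) x) _.
case.
  move=> x /Xc [n _ xn]; near=> y N => /=; exists n.
    by near: N; exact: nbhs_infty_gt.
  near: y; apply: open_nbhs_nbhs; split=> //; exact: open_cylinder.
move=> N _ hN; exists N; exact: (hN N (leqnn N)).
Unshelve. all: by end_near.
Qed.

End Topology.

(** * Hausdorff measure and cylinders *)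

Lemma near_geometric_le (R : realType) (c q eps : R) : 0 < q < 1 -> 0 < eps ->
  \forall n \near \oo, c * q ^+ n <= eps.
Proof.
move=> /andP[q0 q1] eps0.
have /cvgrPdist_le/(_ _ eps0) : geometric c q n @[n --> \oo] --> (0 : R).
  by apply: cvg_geometric; rewrite gtr0_norm.
apply: filterS => n; rewrite sub0r normrN; exact: le_trans (ler_norm _).
Qed.

Lemma sum_geometric_le (R : realType) (q : R) a b : 0 < q < 1 ->
  \sum_(a <= n < b) q ^+ n <= q ^+ a / (1 - q).
Proof.
move=> /andP[q0 q1]; have q1' : 0 < 1 - q by rewrite subr_gt0.
case: (leqP a b) => ab; last first.
  by rewrite big_geq ?(ltnW ab)// divr_ge0 ?exprn_ge0// ltW.
rewrite ler_pdivlMr// mulr_suml.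
rewrite (@telescope_sumr_eq _ _ _ (fun n => - q ^+ n))//.
  by rewrite opprK addrC gerBl exprn_ge0// ltW.
by move=> n _; rewrite mulrBr mulr1 opprK addrC exprSr.
Qed.

Section HausdorffCylinders.
Context (R : realType) (m : nat) (m_ge2 : (2 <= m)%N).

Local Notation rho := (@rho R m).
Local Notation lm := (ln (m%:R : R)).

Lemma m_gt0 : 0 < m%:R :> R. Proof. by rewrite ltr0n (ltn_trans _ m_ge2). Qed.

Lemma lnm_gt0 : 0 < lm. Proof. by rewrite ln_gt0// ltr1n. Qed.

Lemma m_exprN n : m%:R ^- n = expR (- (n%:R * lm)) :> R.
Proof.
by rewrite expRN expRM_natl lnK// posrE m_gt0.
Qed.

Lemma m_exprN_powR n s : (m%:R ^- n) `^ s = expR (- (s * lm * n%:R)) :> R.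
Proof. by rewrite m_exprN -expRM; congr expR; ring. Qed.

Lemma m_exprN_le n k : (m%:R ^- k <= m%:R ^- n :> R) = (n <= k)%N.
Proof. by rewrite !m_exprN ler_expR lerN2 ler_pM2r ?lnm_gt0// ler_nat. Qed.

Lemma rho_le (x y : Sigma m) n :
  (forall k, (k < n)%N -> x k = y k) -> rho x y <= m%:R ^- n.
Proof.
move=> xy; rewrite /Defs.rho; case: pselect => [ne|_]; last first.
  by rewrite m_exprN expR_ge0.
case: ex_minnP => k xyk _; rewrite m_exprN_le leqW// leqNgt.
by apply/negP => /xy /eqP; rewrite (negPf xyk).
Qed.

Lemma rho_first (x y : Sigma m) n : x n != y n ->
  (forall k, (k < n)%N -> x k = y k) -> rho x y = m%:R ^- n.+1.
Proof.
move=> xyn xy; rewrite /Defs.rho; case: pselect => [ne|[]]; last by exists n.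
case: ex_minnP => k xyk /(_ n xyn) kn; congr (_ ^- _.+1).
apply/eqP; rewrite eqn_leq kn leqNgt.
by apply/negP => /xy /eqP; rewrite (negPf xyk).
Qed.

Lemma diam_le (U : set (Sigma m)) (r : R) : 0 <= r ->
  (forall x y, U x -> U y -> rho x y <= r) -> (diam rho U <= r%:E)%E.
Proof.
move=> r0 hr; apply: ge_ereal_sup => _ [->|[[x y] [Ux Uy] <-]].
  by rewrite lee_fin.
by rewrite lee_fin hr.
Qed.

Lemma rho_le_diam (U : set (Sigma m)) x y : U x -> U y ->
  ((rho x y)%:E <= diam rho U)%E.
Proof. by move=> Ux Uy; apply: ereal_sup_ubound; right; exists (x, y). Qed.

Lemma diam_ge0 (U : set (Sigma m)) : (0 <= diam rho U)%E.
Proof. by apply: ereal_sup_ubound; left. Qed.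

Lemma diam_pow0 s : diam_pow rho s set0 = 0%E.
Proof. by rewrite /diam_pow; case: asboolP. Qed.

Lemma diam_pow_ge0 s (U : set (Sigma m)) : (0 <= diam_pow rho s U)%E.
Proof. by rewrite /diam_pow; case: ifP => // _; exact: poweR_ge0. Qed.

Lemma diam_cylinder (u : seq 'I_m) :
  (diam rho (cylinder u) <= (m%:R ^- size u)%:E)%E.
Proof.
apply: diam_le; first by rewrite m_exprN expR_ge0.
move=> x y xu yu; apply: rho_le => k ku.
have -> : x k = nth (x k) u k by rewrite -xu nth_mkseq.
by rewrite -[in RHS](nth_mkseq (x k) y ku) yu.
Qed.

Lemma diam_pow_cylinder s (u : seq 'I_m) : 0 <= s ->
  (diam_pow rho s (cylinder u) <= (expR (- (s * lm * (size u)%:R)))%:E)%E.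
Proof.
move=> s0; rewrite /diam_pow; case: ifP => _; first by rewrite lee_fin expR_ge0.
rewrite -m_exprN_powR -poweR_EFin; apply: gt0_ler_poweR => //.
- by rewrite in_itv /= diam_ge0 leey.
- by rewrite in_itv /= lee_fin leey m_exprN expR_ge0.
- exact: diam_cylinder.
Qed.

Lemma hausdorff_premeasure_ge0 delta s (X : set (Sigma m)) :
  (0 <= hausdorff_premeasure rho delta s X)%E.
Proof.
apply: le_ereal_inf_tmp => _ [U _ <-].
by apply: nneseries_ge0 => n _ _; exact: diam_pow_ge0.
Qed.

Lemma hausdorff_premeasure_le_measure delta s (X : set (Sigma m)) : 0 < delta ->
  (hausdorff_premeasure rho delta s X <= hausdorff_measure rho s X)%E.
Proof. by move=> d0; apply: ereal_sup_ubound; exists delta. Qed.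

(** The cylinders of the words of [G] of length at least [n0] cover [X] for every
    [n0], and their sum is the tail of a geometric series.  They are enumerated
    along a numbering of all words, with the empty set at the unused indices. *)
Lemma hausdorff_measure_eq0 (s : R) (G : pred (seq 'I_m)) (c q : R)
    (X : set (Sigma m)) : 0 <= s -> 0 < q < 1 -> 0 <= c ->
  (forall x n0, X x -> exists2 n, (n0 <= n)%N & G (mkseq x n)) ->
  (forall n, \sum_(u <- words 'I_m n | G u) expR (- (s * lm * (size u)%:R))
     <= c * q ^+ n) ->
  hausdorff_measure rho s X = 0%E.
Proof.
move=> s0 /andP[q0 q1] c0 GX Gsum; apply/eqP; rewrite eq_le; apply/andP; split.
  apply: ge_ereal_sup => _ [delta /= delta0 <-].
  apply/lee_addgt0Pr => eta eta0; rewrite add0e.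
  have [n0 n0delta n0eta] : exists2 n0, m%:R ^- n0 <= delta &
      c * (q ^+ n0 / (1 - q)) <= eta.
    have mi : 0 < (m%:R^-1 : R) < 1.
      by rewrite invr_gt0 m_gt0 invf_lt1 ?m_gt0// ltr1n.
    have q01 : 0 < q < 1 by rewrite q0.
    near \oo => n; exists n; last first.
      rewrite [q ^+ n / _]mulrC mulrA.
      by near: n; exact: near_geometric_le.
    rewrite -exprVn -[leLHS]mul1r.
    by near: n; exact: near_geometric_le.
  pose good u := G u && (n0 <= size u)%N.
  pose U k : set (Sigma m) := if pickle_inv k is Some u then
    (if good u then cylinder u else set0) else set0.
  have Ucov : delta_cover rho delta X U.
    split=> [x Xx|k].
      have [n n0n Gn] := GX x n0 Xx; exists (pickle (mkseq x n)) => //.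
      by rewrite /U pickleK_inv /good Gn size_mkseq n0n /cylinder /= size_mkseq.
    have d0 : (diam rho set0 <= delta%:E)%E by apply: diam_le => //; exact: ltW.
    rewrite /U; case: pickle_inv => [u|//]; case: ifPn => // /andP[_ n0u].
    apply: le_trans (diam_cylinder u) _; rewrite lee_fin.
    by apply: le_trans n0delta; by rewrite m_exprN_le.
  apply: (le_trans (ereal_inf_lbound _)); first by exists U.
  apply: lime_le; first by apply: is_cvg_nneseries => n _ _; exact: diam_pow_ge0.
  near=> N; pose E (u : seq 'I_m) : R := expR (- (s * lm * (size u)%:R)).
  pose S := [seq u <- pmap pickle_inv (iota 0 N) | good u].
  apply: le_trans (_ : (\sum_(u <- S) E u)%:E <= _)%E.
    rewrite /S big_filter -sumEFin [leRHS]big_mkcond big_pmap.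
    rewrite /index_iota subn0; apply: lee_sum => k _; rewrite /U; case: pickle_inv => [u|] /=.
      by case: ifP => _; [exact: diam_pow_cylinder|rewrite diam_pow0].
    by rewrite diam_pow0.
  rewrite lee_fin; pose n1 := (\max_(u <- S) size u).+1.
  have -> : \sum_(u <- S) E u = \sum_(u <- S | G u) E u.
    rewrite big_seq [RHS]big_seq_cond; apply: eq_bigl => u.
    by rewrite mem_filter /good; case: (G u); rewrite ?andbT ?andbF.
  apply: le_trans (@sum_words_le R _ S n0 n1 G E _ _ _) _.
  - by rewrite filter_uniq// (pmap_uniq (@pickle_invK _))// iota_uniq.
  - by move=> u _; exact: expR_ge0.
  - move=> u uS; apply/andP; split; last first.
      by rewrite /n1 ltnS; exact: leq_bigmax_seq.
    by move: uS; rewrite mem_filter => /andP[/andP[]].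
  apply: le_trans n0eta.
  apply: le_trans (_ : \sum_(n0 <= n < n1) c * q ^+ n <= _); first exact: ler_sum.
  by rewrite -mulr_sumr ler_wpM2l// sum_geometric_le// q0.
apply: le_trans (hausdorff_premeasure_ge0 1 s X) _.
exact: hausdorff_premeasure_le_measure.
Unshelve. all: by end_near.
Qed.

(** If two points of [U] differ, the first index at which this happens gives a
    cylinder of size comparable to the diameter.  Otherwise [U] has at most one
    point and diameter 0, and a tiny cylinder is used, at the cost [theta]; the
    larger exponent [s'] makes this possible even when [s = 0]. *)
Lemma sub_cylinder (j0 : 'I_m) (s s' theta : R) n0 (U : set (Sigma m)) :
  0 <= s -> s < s' -> 0 < theta -> (diam rho U <= (m%:R ^- n0.+1)%:E)%E ->
  exists u : seq 'I_m, [/\ U `<=` cylinder u, (n0 <= size u)%N &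
    ((expR (- (s' * lm * (size u)%:R)))%:E <=
      (expR (s' * lm))%:E * diam_pow rho s U + theta%:E)%E].
Proof.
move=> s0 ss' th0 hd; have s'0 : 0 < s' by exact: le_lt_trans ss'.
case: (pselect (exists k, `[< exists x y, [/\ U x, U y & x k != y k] >])).
  case/ex_minnP => k /asboolP[x [y [Ux Uy xyk]]] kmin.
  have agree x' y' l : U x' -> U y' -> (l < k)%N -> x' l = y' l.
    move=> Ux' Uy' lk; apply/eqP; apply: contraT => ne.
    have /kmin : `[< exists x y, [/\ U x, U y & x l != y l] >].
      by apply/asboolP; exists x', y'.
    by rewrite leqNgt lk.
  have rk : ((m%:R ^- k.+1)%:E <= diam rho U)%E.
    rewrite -(rho_first xyk) ?rho_le_diam// => l lk; exact: agree.
  exists (mkseq x k); rewrite size_mkseq; split.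
  - move=> z Uz; rewrite /cylinder /= size_mkseq; apply/eq_in_map => l.
    by rewrite mem_iota add0n => lk; exact: agree.
  - by have := le_trans rk hd; rewrite lee_fin m_exprN_le.
  - have -> : diam_pow rho s U = (diam rho U `^ s)%E.
      by rewrite /diam_pow; case: asboolP => // U0; move: Ux; rewrite U0.
    apply: le_trans (_ : (expR (s' * lm))%:E * ((m%:R ^- k.+1) `^ s)%:E <= _)%E.
      rewrite m_exprN_powR -EFinM lee_fin -expRD ler_expR -[k.+1%:R]natr1.
      rewrite -subr_ge0.
      rewrite (_ : _ - _ = (s' - s) * (lm * (k%:R + 1))); last by ring.
      rewrite mulr_ge0 ?subr_ge0 ?(ltW ss')// mulr_ge0 ?(ltW lnm_gt0)//.
    rewrite -[leLHS]adde0; apply: leeD; last by rewrite lee_fin ltW.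
    apply: lee_wpmul2l; first by rewrite lee_fin expR_ge0.
    rewrite -poweR_EFin; apply: gt0_ler_poweR => //.
      by rewrite in_itv /= lee_fin leey m_exprN expR_ge0.
    by rewrite in_itv /= diam_ge0 leey.
move=> nodiff.
have [x Ux] : exists x : Sigma m, forall y, U y -> forall k, y k = x k.
  case: (pselect (U !=set0)) => [[x Ux]|U0]; last first.
    by exists (fun=> j0) => y Uy; case: U0; exists y.
  exists x => y Uy k; apply/eqP; apply: contraT => ne; case: nodiff; exists k.
  by apply/asboolP; exists y, x.
have [n n0n hn] : exists2 n, (n0 <= n)%N & expR (- (s' * lm * n%:R)) <= theta.
  near \oo => n; exists n; first by near: n; exact: nbhs_infty_ge.
  rewrite (_ : expR _ = 1 * expR (- (s' * lm)) ^+ n).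
    near: n; apply: near_geometric_le => //.
    by rewrite expR_gt0 -[ltRHS]expR0 ltr_expR oppr_lt0 mulr_gt0 ?lnm_gt0.
  by rewrite mul1r -expRM_natl; congr expR; ring.
exists (mkseq x n); rewrite size_mkseq; split=> //.
  move=> y Uy; rewrite /cylinder /= size_mkseq; apply: eq_map => k; exact: Ux.
apply: le_trans (_ : theta%:E <= _)%E; first by rewrite lee_fin.
by rewrite leeDr// mule_ge0 ?diam_pow_ge0// lee_fin expR_ge0.
Unshelve. all: by end_near.
Qed.

(** The error terms [theta] are chosen summable. *)
Lemma null_set_cylinder_cover (j0 : 'I_m) (s s' eta : R) n0 (X : set (Sigma m)) :
  0 <= s -> s < s' -> 0 < eta -> hausdorff_measure rho s X = 0%E ->
  exists c : nat -> seq 'I_m, [/\ X `<=` \bigcup_n cylinder (c n),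
    forall n, (n0 <= size (c n))%N &
    forall N, \sum_(n < N) expR (- (s' * lm * (size (c n))%:R)) <= eta].
Proof.
move=> s0 ss' eta0 H0.
pose K := expR (s' * lm); have K0 : 0 < K by exact: expR_gt0.
have : (hausdorff_premeasure rho (m%:R ^- n0.+1) s X < (eta / 2 / K)%:E)%E.
  apply: le_lt_trans (hausdorff_premeasure_le_measure _ _ _) _.
    by rewrite m_exprN expR_gt0.
  by rewrite H0 lte_fin !divr_gt0.
move=> /ereal_inf_lt [_ [U [XU dU] <-] hU].
have th0 n : 0 < eta / 2 * (2^-1) ^+ n.+1.
  by rewrite mulr_gt0 ?divr_gt0// exprn_gt0.
have /choice [c hc] := fun n =>
  @sub_cylinder j0 s s' _ n0 (U n) s0 ss' (th0 n) (dU n).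
exists c; split=> [x /XU [n _ Unx]|n|N].
- by exists n => //; have [+ _ _] := hc n; apply.
- by have [] := hc n.
have : ((\sum_(n < N) expR (- (s' * lm * (size (c n))%:R)))%:E <=
    K%:E * \sum_(n < N) diam_pow rho s (U n) +
    (\sum_(n < N) eta / 2 * (2^-1) ^+ n.+1)%:E)%E.
  rewrite -!sumEFin ge0_sume_distrr; last by move=> n _; exact: diam_pow_ge0.
  rewrite -big_split /=; apply: lee_sum => n _.
  by have [_ _] := hc n.
have h1 : (\sum_(n < N) diam_pow rho s (U n) <= (eta / 2 / K)%:E)%E.
  apply: le_trans (ltW hU); rewrite -(big_mkord xpredT (fun n => diam_pow rho s (U n))).
  by apply: nneseries_lim_ge => n _ _; exact: diam_pow_ge0.
have h2 : \sum_(n < N) eta / 2 * (2^-1) ^+ n.+1 <= eta / 2.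
  rewrite -mulr_sumr ler_piMr ?divr_ge0 ?(ltW eta0)//.
  have -> : \sum_(n < N) (2^-1 : R) ^+ n.+1 = 1 - 2^-1 ^+ N.
    elim: N {h1} => [|N IHN]; first by rewrite big_ord0 expr0 subrr.
    by rewrite big_ord_recr /= IHN exprS; field.
  by rewrite gerBl exprn_ge0.
move=> h; rewrite -lee_fin; apply: le_trans h _.
rewrite [eta in leRHS]splitr EFinD; apply: leeD; last by rewrite lee_fin.
rewrite -[in leRHS](divfK (lt0r_neq0 K0) (eta / 2)) mulrC EFinM.
by apply: lee_wpmul2l => //; rewrite lee_fin ltW.
Qed.

End HausdorffCylinders.

(** * Masses of covers *)

Section MassCover.
Context (R : realType) (T : finType) (j0 : T) (A : pred (seq T))
  (f : seq T -> R) (e : nat -> R) (ts : tree_system A f e)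
  (ell : nat -> nat) (cop : pred nat) (fs : factor_system ell cop).

Local Notation mass := (mass j0 A f e ell cop).

Lemma sum_mass_prefix u k :
  \sum_(v <- words T (size u + k) | take (size u) v == u) mass v = mass u.
Proof.
elim: k => [|k IHk].
  rewrite addn0 -big_filter (@eq_in_filter _ _ (pred1 u)) => [|v].
    by rewrite filter_pred1_uniq ?words_uniq ?mem_words// big_seq1.
  by rewrite mem_words => /eqP <-; rewrite take_size.
rewrite addnS big_mkcond big_wordsS -[RHS]IHk [RHS]big_mkcond.
rewrite big_seq [RHS]big_seq; apply: eq_bigr => v; rewrite mem_words => /eqP vk.
have tk j : take (size u) (rcons v j) = take (size u) v.
  by rewrite -cats1 takel_cat// vk leq_addr.
under eq_bigr do rewrite tk.
by case: eqP => _; [exact: (sum_mass_rcons j0 ts fs)|rewrite big1].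
Qed.

(** Refine everything to the length [L]: the words of positive mass of that length
    have total mass 1, and each extends a word of [C]. *)
Lemma mass_cover_ge1 (C : seq (seq T)) L :
  {in C, forall u, (size u <= L)%N} ->
  (forall v, size v = L -> 0 < mass v ->
    exists2 u, u \in C & take (size u) v = u) ->
  1 <= \sum_(u <- C) mass u.
Proof.
move=> CL hC; rewrite -(sum_mass j0 ts fs L).
have -> : \sum_(u <- C) mass u =
    \sum_(u <- C) \sum_(v <- words T L | take (size u) v == u) mass v.
  rewrite big_seq [RHS]big_seq; apply: eq_bigr => u uC.
  by rewrite -{1}(sum_mass_prefix u (L - size u)) subnKC// CL.
rewrite (exchange_big_dep predT)//= big_seq [leRHS]big_seq.
apply: ler_sum => v; rewrite mem_words => /eqP vL.
have [m0|m0] := ltP 0 (mass v); last first.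
  by apply: le_trans m0 _; apply: sumr_ge0 => u _; exact: mass_ge0.
have [u uC uv] := hC v vL m0.
rewrite (big_rem u)//= uv eqxx lerDl; apply: sumr_ge0 => u' _; exact: mass_ge0.
Qed.

End MassCover.

(** * Dimension of the multiplicatively invariant set *)

(** The value at 0 is the exponent of the recursion at the empty word. *)
Definition rate (R : realType) (ell : nat -> nat) (k : nat) : R :=
  if k is k'.+1 then (ell k)%:R / (ell k')%:R else gamma R ell.

Definition prefixes (m : nat) (Omega : set (Sigma m)) : pred (seq 'I_m) :=
  fun u => u \in Pref Omega.

Section Prefixes.
Context (R : realType) (m J : nat) (p : 'I_J -> nat) (ell : nat -> nat)
  (Omega : set (Sigma m)) (t : seq 'I_m -> R).

Local Notation pre := (prefixes Omega).

Lemma prefixesP k u : size u = k -> (u \in Prefk Omega k) = pre u.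
Proof.
move=> uk; apply/idP/idP; rewrite /prefixes !inE => h; first by exists k.
by have [k' _ h'] := h; rewrite -uk; move: (h') => [-> _].
Qed.

Lemma prefixes_mkseq y k : Omega y -> pre (mkseq y k).
Proof.
move=> Oy; rewrite -(@prefixesP k) ?size_mkseq// inE; split.
  by rewrite size_mkseq.
by exists y; split=> //; rewrite /cylinder /= size_mkseq.
Qed.

Lemma prefixes_ex u : pre u ->
  exists2 y, Omega y & mkseq y (size u) = u.
Proof.
by rewrite -(@prefixesP (size u))// inE => -[_ [y [Oy yu]]]; exists y.
Qed.

Lemma prefixes_tree_system : Omega !=set0 ->
  (forall u, Pref Omega u -> 1 <= t u) ->
  (t [::] `^ gamma R ell =
      \sum_(j < m | [:: j] \in Prefk Omega 1) t [:: j]) ->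
  (forall k u, Prefk Omega k.+1 u ->
      t u `^ ((ell k.+1)%:R / (ell k)%:R) =
      \sum_(j < m | rcons u j \in Prefk Omega k.+2) t (rcons u j)) ->
  tree_system pre (fun u => ln (t u)) (rate R ell).
Proof.
move=> [y0 Oy0] t_ge1 t_nil_eq t_eq.
have t1 u : pre u -> 1 <= t u by move=> ?; apply/t_ge1/set_mem.
have t0 u : pre u -> 0 < t u by move=> /t1; exact: lt_le_trans.
split=> [|w j /prefixes_ex [y Oy]|w Aw|w Aw].
- exact: (prefixes_mkseq 0 Oy0).
- rewrite size_rcons mkseqS => /rcons_inj [<- _].
  by have := prefixes_mkseq (size w) Oy.
- by rewrite /= ln_ge0// t1.
have -> : expR (rate R ell (size w) * ln (t w)) = t w `^ rate R ell (size w).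
  by rewrite /powR gt_eqF// t0.
transitivity (\sum_(j | pre (rcons w j)) t (rcons w j)); last first.
  by apply: eq_bigr => j Aj; rewrite /= lnK// posrE t0.
case E : (size w) => [|k] /=.
  move: E Aw => /size0nil -> _; rewrite t_nil_eq; apply: eq_bigl => j.
  by rewrite prefixesP.
rewrite t_eq; last by apply: set_mem; rewrite prefixesP.
by apply: eq_bigl => j; rewrite prefixesP// size_rcons E.
Qed.

(** Points of [Omega] can be prescribed freely on the classes, because these are
    disjoint; hence a word of positive mass is a prefix of a point of [X]. *)
Lemma admissible_extend (j0 : 'I_m) v : factor_system ell (coprime_to p) ->
  admissible j0 pre ell (coprime_to p) v ->
  exists x, X_set p ell Omega x /\ mkseq x (size v) = v.
Proof.
move=> fs adm.
have /choice [y hy] : forall i, exists y : Sigma m, coprime_to p i ->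
    Omega y /\ mkseq y (cnt ell i (size v)) = subword j0 ell i v.
  move=> i; case ci : (coprime_to p i); last by exists (fun=> j0).
  have [y Oy yv] := prefixes_ex (adm i ci).
  by exists y => _; split=> //; rewrite -(size_subword j0).
have /choice [ik hik] : forall n, exists ik : nat * nat,
    coprime_to p ik.1 /\ n.+1 = (ik.1 * ell ik.2)%N.
  by move=> n; have [i [k]] := factor_ex fs (ltn0Sn n); exists (i, k).
pose x : Sigma m := fun n => y (ik n).1 (ik n).2.
have xE i k : coprime_to p i -> x (i * ell k).-1 = y i k.
  move=> ci; have [ci' E] := hik (i * ell k).-1.
  rewrite /x; move: ci' E; case: (ik _) => i' k' /= ci'.
  rewrite prednK; last by rewrite muln_gt0 (cop_gt0 fs ci) (ell_gt0 fs).
  by move=> /(factor_uniq fs ci ci') [<- <-].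
exists x; split=> [i i0 ip|].
  have ci : coprime_to p i by rewrite /coprime_to i0; apply/forallP.
  have [Oy _] := hy i ci.
  by rewrite (_ : restr ell i x = y i)//; apply/funext => k; exact: xE.
apply: (@eq_from_nth _ j0); rewrite size_mkseq// => n nv.
rewrite nth_mkseq//; have [ci E] := hik n; set i := (ik n).1 in ci E.
have [_ yv] := hy i ci.
have kc : ((ik n).2 < cnt ell i (size v))%N.
  by rewrite (ltn_cnt fs) ?(cop_gt0 fs)// -E.
have := congr1 (fun s => nth j0 s (ik n).2) yv.
by rewrite nth_mkseq// /subword nth_mkseq// -E.
Qed.

End Prefixes.

Section Dimension.
Context (R : realType) (m J : nat) (m_ge2 : (2 <= m)%N) (p : 'I_J -> nat)
  (ell : nat -> nat) (Omega : set (Sigma m)) (j0 : 'I_m) (f : seq 'I_m -> R)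
  (ts : tree_system (prefixes Omega) f (rate R ell))
  (fs : factor_system ell (coprime_to p))
  (d C : R) (hd : has_density (coprime_to p) d C).

Local Notation mass :=
  (mass j0 (prefixes Omega) f (rate R ell) ell (coprime_to p)).
Local Notation X := (X_set p ell Omega).
Local Notation lm := (ln (m%:R : R)).
Local Notation f0 := (f [::]).

Let lm0 : 0 < lm. Proof. exact: lnm_gt0. Qed.

Lemma hausdorff_dim_X_set_le :
  (hausdorff_dim (@rho R m) X <= (f0 / lm)%:E)%E.
Proof.
apply/lee_addgt0Pr => eps eps0; rewrite -EFinD.
pose del := eps * lm / 2.
have del0 : 0 < del by rewrite divr_gt0 ?mulr_gt0.
have sE : (f0 / lm + eps) * lm = f0 + del + del.
  by rewrite mulrDl divfK ?gt_eqF// -addrA -splitr.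
have f00 : 0 <= f0 by exact: tree_ge0 ts _ (tree_nil ts).
have s0 : 0 <= f0 / lm + eps.
  by rewrite addr_ge0 ?divr_ge0 ?(ltW lm0) ?(ltW eps0).
apply: ereal_inf_lbound; exists (f0 / lm + eps) => //; split=> //.
(* One [del] makes heavy words frequent, the other one makes the sum over all
   their lengths converge. *)
pose G u := expR (- (size u)%:R * (f0 + del)) <= mass u.
apply: (@hausdorff_measure_eq0 R m m_ge2 _ G 1 (expR (- del))) => //.
- by rewrite expR_gt0 -[ltRHS]expR0 ltr_expR oppr_lt0.
- move=> x n0 Xx.
  have [|n n0n hn] := mass_large_infinitely_often j0 ts fs erefl
      (fun=> erefl) hd (x := x) _ n0 del0.
    move=> i k /andP[i0 /forallP ip]; apply: prefixes_mkseq (Xx i i0 ip).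
  by exists n => //; rewrite /G size_mkseq.
move=> n; rewrite sE mul1r -[leRHS]mulr1.
rewrite -[X in _ <= _ * X](sum_mass j0 ts fs n) mulr_sumr.
rewrite big_mkcond big_seq [leRHS]big_seq; apply: ler_sum => u.
rewrite mem_words => /eqP un; case: ifPn => [Gu|_]; last first.
  by rewrite mulr_ge0 ?exprn_ge0 ?expR_ge0 ?mass_ge0.
apply: le_trans (ler_wpM2l _ Gu); last by rewrite exprn_ge0 ?expR_ge0.
by rewrite -expRM_natl -expRD ler_expR un; nra.
Qed.

Lemma hausdorff_dim_X_set_ge : closed Omega ->
  (forall w k, prefixes Omega w -> size w = k.+1 ->
    f w <= lm * ((ell k)%:R * inv_sum_from R ell k.+1)) ->
  ((f0 / lm)%:E <= hausdorff_dim (@rho R m) X)%E.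
Proof.
move=> Omega_closed f_le.
apply: le_ereal_inf_tmp => _ [s [s0 Hs0] <-]; rewrite lee_fin leNgt.
apply/negP => sf.
pose s' := (s + f0 / lm) / 2.
have ss' : s < s' by rewrite midf_lt.
have s'f : s' < f0 / lm by rewrite midf_lt.
pose eps := f0 - s' * lm.
have eps0 : 0 < eps by rewrite subr_gt0 -ltr_pdivlMr.
have [c [q [c0 q01 hcq]]] := sum_large_mass_geometric j0 ts fs erefl
  (fun=> erefl) hd (ltW lm0) f_le eps0.
have third : 0 < 3^-1 :> R by [].
(* Heavy words of length at least [n0] have total mass at most 1/3, and the
   cover by [w] has Hausdorff sum at most 1/3. *)
have [n0 hn0] : exists n0, c * (q ^+ n0 / (1 - q)) <= 3^-1.
  near \oo => n; exists n; rewrite [q ^+ n / _]mulrC mulrA.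
  by near: n; exact: near_geometric_le.
have [w [Xw wn0 wsum]] :=
  null_set_cylinder_cover m_ge2 j0 n0 s0 ss' third Hs0.
have [N XN] := compact_cylinders (compact_X_set Omega_closed) Xw.
pose S := undup [seq w n | n <- iota 0 N].
pose L := \max_(u <- S) size u.
have SL : {in S, forall u, (size u <= L)%N}.
  by move=> u uS; exact: leq_bigmax_seq.
have : 1 <= \sum_(u <- S) mass u.
  apply: (mass_cover_ge1 ts fs SL) => v vL v0.
  have [x [Xx xv]] := admissible_extend fs (mass_gt0 ts fs v0).
  have [n nN xn] := XN x Xx; exists (w n).
    by rewrite mem_undup; apply: map_f; rewrite mem_iota.
  have wS : w n \in S by rewrite mem_undup; apply: map_f; rewrite mem_iota.
  rewrite -xv vL -{2}xn /mkseq -map_take take_iota; congr map; congr iota.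
  by apply/minn_idPl; exact: SL.
rewrite leNgt => /negP; apply.
pose large u := expR (- (size u)%:R * (f0 - eps)) < mass u.
rewrite (bigID large) /=; apply: le_lt_trans (_ : 3^-1 + 3^-1 < 1); last by lra.
apply: lerD.
  apply: le_trans (@sum_words_le R _ S n0 L.+1 large mass _ _ _) _.
  - exact: undup_uniq.
  - by move=> u _; exact: mass_ge0.
  - move=> u uS; rewrite ltnS SL// andbT.
    by move: uS; rewrite mem_undup => /mapP[n _ ->].
  apply: le_trans hn0; apply: le_trans (_ : \sum_(n0 <= n < L.+1) c * q ^+ n <= _).
    apply: ler_sum => n _; apply: le_trans (hcq n).
    rewrite le_eqVlt; apply/orP; left; apply/eqP.
    rewrite big_seq_cond [RHS]big_seq_cond; apply: eq_bigl => u.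
    rewrite mem_words; case: eqP => //= un.
    by rewrite /large un.
  by rewrite -mulr_sumr ler_wpM2l// sum_geometric_le.
apply: le_trans (wsum N).
pose F (u : seq 'I_m) : R := expR (- (s' * lm * (size u)%:R)).
apply: le_trans (_ : \sum_(u <- S) F u <= _).
  rewrite big_mkcond; apply: ler_sum => u _; case: ifPn => [|_]; last exact: expR_ge0.
  rewrite -leNgt => /le_trans; apply; rewrite ler_expR /eps.
  by rewrite opprB addrC subrK mulNr mulrC.
apply: le_trans (sum_undup_le _ _) _; first by move=> u; exact: expR_ge0.
by rewrite big_map -{1}[N]subn0 -/(index_iota 0 N) big_mkord.
Unshelve. all: by end_near.
Qed.

End Dimension.

Unset Implicit Arguments.

Theorem theorem2p5 (R : realType) (m J : nat) (p : 'I_J -> nat)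
    (ell : nat -> nat) (Omega : set (Sigma m)) (t : seq 'I_m -> R)
    (m_ge2 : (2 <= m)%N) (J_ge2 : (2 <= J)%N)
    (p_prime : forall j, prime (p j)) (p_inj : injective p)
    (ell_enum : increasing_enum (semigroup p) ell)
    (Omega_neq0 : Omega !=set0) (Omega_closed : closed Omega)
    (t_ge1 : forall u, Pref Omega u -> 1 <= t u)
    (t_nil_bounds : 1 <= t [::] <= m%:R)
    (t_bounds : forall k u, Prefk Omega k.+1 u ->
      1 <= t u <= m%:R `^ ((ell k)%:R * inv_sum_from R ell k.+1))
    (t_nil_eq : t [::] `^ gamma R ell =
      \sum_(j < m | [:: j] \in Prefk Omega 1) t [:: j])
    (t_eq : forall k u, Prefk Omega k.+1 u ->
      t u `^ ((ell k.+1)%:R / (ell k)%:R) =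
      \sum_(j < m | rcons u j \in Prefk Omega k.+2) t (rcons u j)) :
  hausdorff_dim (@rho R m) (X_set p ell Omega) = (logb m%:R (t [::]))%:E.
Proof.
have [y0 _] := Omega_neq0; pose j0 := y0 0%N.
have ts := prefixes_tree_system Omega_neq0 t_ge1 t_nil_eq t_eq.
have fs := prime_factor_system p_prime ell_enum.
have [d [C hd]] := prime_density p_prime R.
apply/eqP; rewrite eq_le; apply/andP; split.
  exact: (hausdorff_dim_X_set_le m_ge2 j0 ts fs hd).
apply: (hausdorff_dim_X_set_ge m_ge2 j0 ts fs hd) => // w k Aw wk.
have /t_bounds/andP[t1 tm] : Prefk Omega k.+1 w.
  by apply: set_mem; rewrite prefixesP.
rewrite mulrC -ln_powR ler_ln ?posrE ?powR_gt0 ?m_gt0//.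
exact: lt_le_trans t1.
Qed.
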